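(* Let $\mathbf{M}$ be a compact smooth $m$-dimensional submanifold without boundary of $\mathbf{R}^s$, with cutlocus $\mathbf{C}$ and nearest-point mapping $\pi:\mathbf{R}^s\setminus\mathbf{C}\to\mathbf{M}$. Let $(t_n)$ be a sequence in $\mathbf{R}^s$, let $(\tilde t_n)$ be random vectors in $\mathbf{R}^s$, and let $B_n$ be nonsingular $s\times s$ matrices with $B_n\to 0$ such that $$Z_n=B_n^{-1}(\tilde t_n-t_n)\xrightarrow{\mathcal D} Z\quad (n\to\infty)$$ for some random vector $Z$ in $\mathbf{R}^s$. Put $\mu_n=\pi(t_n)$ and $\tilde\mu_n=\pi(\tilde t_n)$. Suppose $t_n\notin\mathbf{C}$ and $d(t_n,\mathbf{M})\le D$ for all $n$, for some constant $D>0$. If $\|B_n\|/d(t_n,\mathbf{C})\to 0$, then $\|\tilde\mu_n-\mu_n\|\to 0$ in probability.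
   Context: $\|\cdot\|$ is the Euclidean norm on $\mathbf{R}^s$ and the operator norm on matrices; for a closed set $A\subset\mathbf{R}^s$, $d(t,A)=\inf_{a\in A}\|t-a\|$. For $x\in\mathbf{R}^s$ let $L_x(\mu)=\|\mu-x\|^2$, $\mu\in\mathbf{M}$. The cutlocus $\mathbf{C}$ is the (closed) set of $x\in\mathbf{R}^s$ such that either the minimizer of $L_x$ over $\mathbf{M}$ is not unique, or $L_x$ has a degenerate second derivative (Hessian) at its minimizer. For $x\notin\mathbf{C}$, $\pi(x)=\arg\min_{\mu\in\mathbf{M}}\|\mu-x\|$. Convergence in distribution is denoted $\xrightarrow{\mathcal D}$. *)

(* Defs.v *)
From HB Require Import structures.
From mathcomp Require Import all_boot all_order all_algebra.
From mathcomp Require Import all_classical all_reals all_analysis.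
Set Implicit Arguments. Unset Strict Implicit. Unset Printing Implicit Defensive.
Import Order.TTheory GRing.Theory Num.Theory.
Import numFieldNormedType.Exports.
Local Open Scope classical_set_scope.
Local Open Scope ring_scope.

Section Defs.
Variable R : realType.

Definition sqnorm {k : nat} (x : 'cV[R]_k) : R := \sum_(i < k) (x i 0) ^+ 2.
Definition enorm {k : nat} (x : 'cV[R]_k) : R := Num.sqrt (sqnorm x).

Definition opnorm {k : nat} (B : 'M[R]_k) : R :=
  sup [set enorm (B *m v) | v in [set v : 'cV[R]_k | enorm v <= 1]].

Definition dist {k : nat} (t : 'cV[R]_k) (A : set 'cV[R]_k) : R :=
  inf [set enorm (t - a) | a in A].

Definition evec {k : nat} (j : 'I_k) : 'cV[R]_k := delta_mx j 0.
Definition pd {k : nat} {W : normedModType R} (j : 'I_k)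
  (f : 'cV[R]_k -> W) : 'cV[R]_k -> W := fun x => derive f x (evec j).

Fixpoint iterpd {k : nat} {W : normedModType R} (js : seq 'I_k)
  (f : 'cV[R]_k -> W) : 'cV[R]_k -> W :=
  match js with [::] => f | j :: js' => pd j (iterpd js' f) end.

Definition smooth_on {k : nat} {W : normedModType R} (O : set 'cV[R]_k)
  (f : 'cV[R]_k -> W) : Prop :=
  forall js : seq 'I_k,
    (forall x, O x -> forall j, derivable (iterpd js f) x (evec j)) /\
    {within O, continuous (iterpd js f)}.

Definition jacobian {m s : nat} (phi : 'cV[R]_m -> 'cV[R]_s) (w : 'cV[R]_m)
  : 'M[R]_(s, m) := \matrix_(i < s, j < m) (pd j phi w) i 0.

Definition local_param {m s : nat} (M : set 'cV[R]_s)
  (O : set 'cV[R]_m) (U : set 'cV[R]_s) (phi : 'cV[R]_m -> 'cV[R]_s) : Prop :=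
  [/\ open O /\ open U, smooth_on O phi,
      phi @` O = M `&` U,
      (forall w, O w -> \rank (jacobian phi w) = m) &
      exists psi : 'cV[R]_s -> 'cV[R]_m,
        [/\ {within M `&` U, continuous psi},
            (forall w, O w -> psi (phi w) = w) &
            (forall p, (M `&` U) p -> phi (psi p) = p)]].

Definition smooth_submanifold (m s : nat) (M : set 'cV[R]_s) : Prop :=
  forall p, M p -> exists (O : set 'cV[R]_m) (U : set 'cV[R]_s) phi,
    U p /\ local_param M O U phi.

Definition Lx {s : nat} (x mu : 'cV[R]_s) : R := sqnorm (mu - x).

Definition is_minimizer {s : nat} (M : set 'cV[R]_s) (x mu : 'cV[R]_s) : Prop :=
  M mu /\ forall nu, M nu -> Lx x mu <= Lx x nu.

Definition chart_hessian {m s : nat} (x : 'cV[R]_s)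
  (phi : 'cV[R]_m -> 'cV[R]_s) (w0 : 'cV[R]_m) : 'M[R]_m :=
  \matrix_(i < m, j < m) pd i (pd j (fun w => Lx x (phi w))) w0.

Definition degenerate_hessian (m s : nat) (M : set 'cV[R]_s)
  (x mu : 'cV[R]_s) : Prop :=
  exists (O : set 'cV[R]_m) (U : set 'cV[R]_s) phi w0,
    [/\ local_param M O U phi, O w0, phi w0 = mu &
        \det (chart_hessian x phi w0) = 0].

Definition cutlocus (m s : nat) (M : set 'cV[R]_s) : set 'cV[R]_s :=
  [set x | ~ (exists! mu, is_minimizer M x mu) \/
           exists mu, is_minimizer M x mu /\ degenerate_hessian m M x mu].

(* Nearest-point map (meaningful for x outside the cutlocus). *)
Definition nearest {s : nat} (M : set 'cV[R]_s) (x : 'cV[R]_s) : 'cV[R]_s :=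
  xget 0 [set mu | is_minimizer M x mu].

Definition random_vector {d} {T : measurableType d} {s : nat}
  (X : T -> 'cV[R]_s) : Prop :=
  forall i : 'I_s, measurable_fun setT (fun w => X w i 0).

Definition cvg_dist {d d'} {T : measurableType d} {T' : measurableType d'}
  {s : nat} (P : probability T R) (X : nat -> T -> 'cV[R]_s)
  (P' : probability T' R) (X' : T' -> 'cV[R]_s) : Prop :=
  forall f : 'cV[R]_s -> R, continuous f ->
    (exists K : R, forall y, `|f y| <= K) ->
    ((fun n => \int[P]_w (f (X n w))%:E) @ \oo --> \int[P']_w (f (X' w))%:E)%E.

End Defs.

(* Main.v *)
(* Call [x] extendable at its nearest point [mu] if [mu] is still a nearest point of
   [mu + (1 + l) (x - mu)] for some [l > 0], i.e. [2 (1 + l) <x - mu, nu - mu> <= |nu - mu|^2]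
   for all [nu] in [M].  Extendability characterises the complement of the cut locus:
   a nondegenerate unique minimiser has a positive definite chart Hessian, which stays
   nonnegative for nearby base points, so by Taylor's formula nearby critical points are
   local minimisers, and compactness of [M] deals with the far points; conversely, extending
   subtracts a multiple of |J h|^2 from the Hessian form, so the latter was definite.
   The uniformity in the base point also shows that the cut locus is closed.  Hence [mu]
   remains nearest along the ray up to any length below [d(t, C)], and the displayed
   inequality (as for sets of positive reach) makes the projection Lipschitz at [t] with
   constant [2 (2 D + d(t, C)) / d(t, C)].  Finally |tt - t| <= ||B|| |Z_n|, where [Z_n] is
   tight because it converges in distribution. *)
Require Import Defs.
From HB Require Import structures.
From mathcomp Require Import all_boot all_order all_algebra.
From mathcomp Require Import all_classical all_reals all_analysis.
From mathcomp Require Import measurable_realfun ring lra.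
Import Order.TTheory GRing.Theory Num.Theory.
Import numFieldNormedType.Exports.
Local Open Scope classical_set_scope.
Local Open Scope ring_scope.

Set Implicit Arguments.
Unset Strict Implicit.
Unset Printing Implicit Defensive.

(** * Calculus along lines *)

Lemma is_deriveP (R : realType) (V : normedModType R) (f : V -> R) x h l : is_derive x h f l <->
  (fun t : R => t^-1 *: (f (t *: h + x) - f x)) @ 0^' --> l.
Proof.
split=> [[fd <-]|fl]; first exact: fd.
by split; [apply/cvg_ex; exists l|exact/cvg_lim].
Qed.

Section DirectionalDerivatives.
Variables (R : realType) (V : normedModType R).
Implicit Types (f g : V -> R) (a b h x : V).

Lemma is_derive_line f a h (t l : R) : is_derive (a + t *: h) h f l ->
  is_derive t (1 : R) (fun r : R => f (a + r *: h)) l.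
Proof.
have E : (fun r : R => r^-1 *: ((f \o shift (a + t *: h)) (r *: h) - f (a + t *: h)))
    = (fun r : R => r^-1 *: (((fun r : R => f (a + r *: h)) \o shift t) (r *: (1 : R))
         - f (a + t *: h))).
  apply/funext => r /=; congr (_ *: (f _ - _)).
  by rewrite addrC -addrA; congr (_ + _); rewrite -scalerDl [in RHS]/GRing.scale /= mulr1 addrC.
by case; rewrite /derivable /derive E => d dE; split.
Qed.

Lemma line_is_derive f a h (l : R) :
  is_derive (0 : R) (1 : R) (fun r : R => f (a + r *: h)) l -> is_derive a h f l.
Proof.
move=> /is_deriveP L; apply/is_deriveP.
rewrite (_ : (fun t : R => t^-1 *: (f (t *: h + a) - f a)) =
  (fun t : R => t^-1 *: (f (a + (t *: (1 : R) + 0) *: h) - f (a + (0 : R) *: h)))) //.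
apply/funext => r; rewrite scale0r !addr0 (addrC a); congr (_ *: (f (_ *: _ + _) - _)).
by rewrite /GRing.scale /= mulr1.
Qed.

Lemma is_deriveZ_dir f x h (c l : R) :
  is_derive x h f l -> is_derive x (c *: h) f (c * l).
Proof.
move=> df; apply: line_is_derive.
have -> : (fun r : R => f (x + r *: (c *: h))) =
    (fun r : R => f (x + r *: h)) \o (fun r : R => c * r).
  by apply/funext => r /=; rewrite scalerA (mulrC r).
have /is_derive_line d0 : is_derive (x + (c * 0) *: h) h f l.
  by rewrite mulr0 scale0r addr0.
have d1 : is_derive (0 : R) (1 : R) (fun r : R => c * r) c.
  have := @is_deriveZ _ _ _ (id : R -> R) c 0 1 1 _.
  by rewrite scaler1 => H; apply: H.
by rewrite mulrC; exact: is_derive1_comp.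
Qed.

Lemma MVT_line f (df : V -> R) a h :
  (forall t : R, 0 <= t <= 1 -> is_derive (a + t *: h) h f (df (a + t *: h))) ->
  exists2 t : R, 0 < t < 1 & f (a + h) - f a = df (a + t *: h).
Proof.
move=> D.
have D' (t : R) : 0 <= t <= 1 -> is_derive t (1 : R) (fun r : R => f (a + r *: h))
    (df (a + t *: h)) by move=> /D; exact: is_derive_line.
have [||t] := @MVT R (fun r => f (a + r *: h)) (fun r => df (a + r *: h)) 0 1 ltr01.
- by move=> t; rewrite in_itv /= => /andP[t0 t1]; apply: D'; rewrite !ltW.
- apply: derivable_within_continuous => t; rewrite in_itv /= => t01.
  by have [] := D' t t01.
- rewrite in_itv /= scale1r scale0r addr0 subr0 mulr1 => t01 E.
  by exists t.
Qed.

(* The increment along [t (a + b)] is split at [x + t b]: the mean value theorem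
   handles the [a]-part, which is why only that derivative must be continuous. *)
Lemma is_deriveD_dir f g x a b (l : R) :
  (\forall y \near x, is_derive y a f (g y)) -> {for x, continuous g} ->
  is_derive x b f l -> is_derive x (a + b) f (g x + l).
Proof.
move=> fa gx /is_deriveP fb; apply/is_deriveP.
apply/cvgrPdist_le => /= e e0.
have e20 : 0 < e / 2 by rewrite divr_gt0.
have /nbhs_ballP[r /= r0 Br] : \forall y \near x,
    is_derive y a f (g y) /\ `|g x - g y| <= e / 2.
  by apply: filterI => //; move/cvgrPdist_le : gx; exact.
have K0 : 0 < `|a| + `|b| + 1 by rewrite ltr_wpDl// addr_ge0.
move/cvgrPdist_le : fb => /(_ _ e20) fb.
near=> t.
have t0 : t != 0 by near: t; exact: nbhs_dnbhs_neq.
have tr : `|t| * (`|a| + `|b| + 1) < r.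
  rewrite -ltr_pdivlMr//; near: t; apply: dnbhs0_lt.
  by rewrite divr_gt0.
have inball (s : R) : 0 <= s <= 1 -> ball x r (t *: b + x + s *: (t *: a)).
  move=> /andP[s0 s1]; rewrite -ball_normE /=.
  rewrite addrAC opprD addrCA subrr addr0.
  rewrite normrN (le_lt_trans (ler_normD _ _))// !normrZ (le_lt_trans _ tr)//.
  rewrite (ger0_norm s0) mulrDr mulrDr mulr1 addrC -addrA lerD//.
    by rewrite ler_piMl// mulr_ge0.
  by rewrite lerDl.
have [s s01 Es] : exists2 s : R, 0 < s < 1 &
    f (t *: b + x + t *: a) - f (t *: b + x) = t * g (t *: b + x + s *: (t *: a)).
  apply: (@MVT_line f (fun y => t * g y)) => s s01.
  by apply: is_deriveZ_dir; have [] := Br _ (inball s s01).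
have -> : t *: (a + b) + x = t *: b + x + t *: a.
  by rewrite scalerDr -addrA addrC.
rewrite -(subrK (f (t *: b + x)) (f (t *: b + x + t *: a))) Es -[X in _ *: X]addrA scalerDr.
rewrite [_ *: (t * _)](mulKf t0) opprD addrACA (le_trans (ler_normD _ _))//.
rewrite (splitr e) lerD//.
  by apply: (Br _ (inball s _)).2; case/andP: s01 => *; rewrite !ltW.
near: t; exact: fb.
Unshelve. all: by end_near. Qed.

(** Rolle's argument applied twice: [K] makes [v 0 = v 1], so [v'] vanishes at some [a]; it also
    vanishes at 0, so its derivative [u'' - 2 K] vanishes at some [b] in between. *)
Lemma taylor2_01 (u u' u'' : R -> R) :
  (forall t : R, 0 <= t <= 1 -> is_derive t (1 : R) u (u' t)) ->
  (forall t : R, 0 <= t <= 1 -> is_derive t (1 : R) u' (u'' t)) ->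
  exists2 t : R, 0 < t < 1 & u 1 - u 0 = u' 0 + u'' t / 2.
Proof.
move=> du du'; pose K := u 1 - u 0 - u' 0.
pose v (t : R) : R := u t - u' 0 * t - K * t ^+ 2.
pose v' (t : R) : R := u' t - u' 0 - 2 * K * t.
have dv (t : R) : 0 <= t <= 1 -> is_derive t (1 : R) v (v' t).
  move=> /du H.
  have -> : v = u - (u' 0 \*: id) - (K \*: (id ^+ 2)).
    by apply/funext => x.
  apply: is_derive_eq; rewrite /v' /= /GRing.scale /=; ring.
have dv' (t : R) : 0 <= t <= 1 -> is_derive t (1 : R) v' (u'' t - 2 * K).
  move=> /du' H.
  have -> : v' = u' - cst (u' 0) - ((2 * K) \*: id) by apply/funext => x.
  apply: is_derive_eq; rewrite /= /GRing.scale /=; ring.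
have [||a] := @MVT R v v' 0 1 ltr01.
- by move=> t; rewrite in_itv /= => /andP[t0 t1]; apply: dv; rewrite !ltW.
- apply: derivable_within_continuous => t; rewrite in_itv /= => t01.
  by have [] := dv t t01.
rewrite in_itv /= => /andP[a0 a1] Ea.
have v'a : v' a = 0.
  by move: Ea; rewrite subr0 mulr1 => <-; rewrite /v /K; ring.
have [||b] := @MVT R v' (fun t => u'' t - 2 * K) 0 a a0.
- move=> t; rewrite in_itv /= => /andP[t0 ta]; apply: dv'.
  by rewrite ltW//= ltW// (lt_trans ta).
- apply: derivable_within_continuous => t; rewrite in_itv /= => /andP[t0 ta].
  by have [] : is_derive t (1 : R) v' (u'' t - 2 * K)
    by apply: dv'; rewrite t0/= (le_trans ta)// ltW.
rewrite in_itv /= => /andP[b0 ba] Eb.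
exists b; first by rewrite b0 (lt_trans ba).
have v'0 : v' 0 = 0 by rewrite /v'; ring.
move: Eb; rewrite v'a v'0 subrr => /esym/eqP; rewrite subr0 mulf_eq0 (gt_eqF a0) orbF.
by rewrite subr_eq0 => /eqP ->; rewrite /K; field.
Qed.

End DirectionalDerivatives.

(** * Second-order Taylor formula and symmetry of the Hessian *)

Section SecondOrder.
Variables (R : realType) (k : nat).
Implicit Types (O : set 'cV[R]_k) (f : 'cV[R]_k -> R) (g : 'I_k -> 'cV[R]_k -> R)
  (H : 'I_k -> 'I_k -> 'cV[R]_k -> R) (x h : 'cV[R]_k).

Lemma cV_sum_evec h : h = \sum_(j < k) h j 0 *: evec R j.
Proof.
apply/colP => i; rewrite summxE (bigD1 i)//= big1 ?addr0 => [|j ji].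
  by rewrite !mxE !eqxx mulr1.
by rewrite !mxE eq_sym (negbTE ji) mulr0.
Qed.

(** Smoothness is given through partial derivatives only; this recovers all directional ones by
    adding one coordinate direction at a time with [is_deriveD_dir]. *)
Lemma is_derive_gradient f g x h :
  (forall j, \forall y \near x, is_derive y (evec R j) f (g j y)) ->
  (forall j, {for x, continuous (g j)}) ->
  is_derive x h f (\sum_(j < k) h j 0 * g j x).
Proof.
move=> df cg; rewrite [h in is_derive _ h]cV_sum_evec.
elim: (index_enum _) => [|j r IH]; first by rewrite !big_nil; exact: is_derive0.
rewrite !big_cons; apply: (is_deriveD_dir (g := fun y => h j 0 * g j y)) => //.
- by have := df j; apply: filterS => y dfy; exact: is_deriveZ_dir.
- by apply: (@continuousM _ _ (cst (h j 0)) (g j)); [exact: cst_continuous|exact: cg].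
Qed.

(** Gradient and Hessian are carried as explicit functions, so that closed formulas such as
    [chart_gradient] and [chart_hess] can be supplied in place of iterated [derive]. *)
Definition C2_on O f g H := [/\ open O,
  forall x j, O x -> is_derive x (evec R j) f (g j x),
  forall x i j, O x -> is_derive x (evec R i) (g j) (H i j x),
  forall x j, O x -> {for x, continuous (g j)} &
  forall x i j, O x -> {for x, continuous (H i j)}].

Definition quad_form (A : 'I_k -> 'I_k -> R) h : R :=
  \sum_(i < k) \sum_(j < k) h i 0 * h j 0 * A i j.

Lemma taylor2 O f g H x h : C2_on O f g H ->
  (forall t : R, 0 <= t <= 1 -> O (x + t *: h)) ->
  exists2 t : R, 0 < t < 1 & f (x + h) - f x =
    \sum_(j < k) h j 0 * g j x + quad_form (fun i j => H i j (x + t *: h)) h / 2.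
Proof.
move=> [oO df dg cg cH] xhO.
have [||t t01 E] := @taylor2_01 R (fun t => f (x + t *: h))
  (fun t => \sum_(j < k) h j 0 * g j (x + t *: h))
  (fun t => quad_form (fun i j => H i j (x + t *: h)) h).
- move=> t /xhO Ot; apply: is_derive_line; apply: is_derive_gradient => j; last exact: cg.
  by have := open_nbhs_nbhs (conj oO Ot); apply: filterS => y; exact: df.
- move=> t /xhO Ot.
  apply: (is_derive_line (f := fun y => \sum_(j < k) h j 0 * g j y)).
  rewrite /quad_form exchange_big /=.
  have -> : (fun y => \sum_(j < k) h j 0 * g j y) = \sum_(j < k) h j 0 \*: g j.
    by apply/funext => y; rewrite fct_sumE.
  apply: is_derive_sum => j.
  under eq_bigr do rewrite mulrAC mulrC.
  rewrite -mulr_sumr; apply: is_deriveZ.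
  apply: (is_derive_gradient (g := fun i => H i j)) => i; last exact: cH.
  by have := open_nbhs_nbhs (conj oO Ot); apply: filterS => y; exact: dg.
exists t => //; by move: E; rewrite scale1r scale0r addr0 => ->.

Qed.

(** The mean value theorem is applied to the increment [G] in direction [i], then to [g i] in
    direction [j]. The left side is symmetric in [i] and [j], the right side a priori is not. *)
Lemma second_difference O f g H x i j (s : R) : C2_on O f g H ->
  (forall a b : R, 0 <= a <= 1 -> 0 <= b <= 1 ->
     O (x + (a * s) *: evec R i + (b * s) *: evec R j)) ->
  exists a b : R, [/\ 0 < a < 1, 0 < b < 1 &
    f (x + s *: evec R i + s *: evec R j) - f (x + s *: evec R i)
      - (f (x + s *: evec R j) - f x)
    = s * (s * H j i (x + (a * s) *: evec R i + (b * s) *: evec R j))].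
Proof.
move=> [oO df dg cg cH] xO.
pose G y := f (y + s *: evec R j) - f y.
have [|a a01 Ea] := @MVT_line _ _ G
    (fun y => s * (g i (y + s *: evec R j) - g i y)) x (s *: evec R i).
  move=> a a01; apply: is_deriveZ_dir.
  have -> : G = (fun y => f (y + s *: evec R j)) - f by [].
  have Oa : O (x + a *: (s *: evec R i)).
    have := xO a 0 a01; rewrite mul0r scale0r addr0 scalerA; apply.
    by rewrite lexx ler01.
  have Oaj : O (x + a *: (s *: evec R i) + s *: evec R j).
    have := xO a 1 a01; rewrite mul1r scalerA; apply.
    by rewrite lexx ler01.
  apply: is_deriveB; last exact: df.
  have /is_deriveP L := df _ i Oaj.
  apply/is_deriveP; apply: cvg_trans L; apply: near_eq_cvg.
  by apply: nearW => t; rewrite /= addrA.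
have [|b b01 Eb] := @MVT_line _ _ (g i) (fun y => s * H j i y)
    (x + a *: (s *: evec R i)) (s *: evec R j).
  move=> b b01; apply: is_deriveZ_dir; apply: dg.
  by rewrite !scalerA; apply: xO => //; case/andP: a01 => *; rewrite !ltW.
exists a, b; split => //; move: Ea; rewrite Eb /G !scalerA => ->.
by [].
Qed.

(** Schwarz's theorem: evaluating one second difference in both orders shows that [H j i] and
    [H i j] share a value at points arbitrarily close to [x]; continuity at [x] does the rest. *)
Lemma hessian_sym O f g H x i j : C2_on O f g H -> O x -> H i j x = H j i x.
Proof.
move=> C2f Ox; have [oO df dg cg cH] := C2f.
apply/eqP; rewrite -subr_eq0 -normr_le0; apply/ler_addgt0Pl => e e0; rewrite addr0.
have e20 : 0 < e / 2 by rewrite divr_gt0.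
have /nbhs_ballP[r /= r0 Br] : \forall y \near x,
    [/\ O y, `|H i j x - H i j y| <= e / 2 & `|H j i x - H j i y| <= e / 2].
  near=> y; split; near: y; first exact: open_nbhs_nbhs.
  - by move: e20; move: (e / 2); apply/cvgrPdist_le; exact: cH.
  - by move: e20; move: (e / 2); apply/cvgrPdist_le; exact: cH.
pose K : R := `|evec R i| + `|evec R j| + 1.
have K0 : 0 < K by rewrite ltr_wpDl// addr_ge0.
have [s s0 sK] : exists2 s : R, 0 < s & s * K < r.
  exists (r / 2 / K); first by rewrite !divr_gt0.
  by rewrite divfK ?gt_eqF// ltr_pdivrMr// ltr_pMr// ltr1n.
have s_ge0 := ltW s0.
have inB u v (a b : R) : `|u| + `|v| < K -> 0 <= a <= 1 -> 0 <= b <= 1 ->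
    ball x r (x + (a * s) *: u + (b * s) *: v :> 'cV[R]_k).
  move=> uvK /andP[a0 a1] /andP[b0 b1].
  rewrite -ball_normE /= -addrA opprD addrA subrr add0r normrN.
  rewrite (le_lt_trans (ler_normD _ _))// !normrZ (le_lt_trans _ sK)//.
  rewrite !ger0_norm ?mulr_ge0//.
  rewrite (@le_trans _ _ (s * (`|u| + `|v|)))//; last by rewrite ler_wpM2l// ltW.
  by rewrite mulrDr; apply: lerD; rewrite -mulrA ler_piMl// mulr_ge0.
have Kij : `|evec R i| + `|evec R j| < K by rewrite ltrDl.
have Kji : `|evec R j| + `|evec R i| < K by rewrite addrC.
have := @second_difference O f g H x i j s C2f.
case=> [? ? p01 q01|p [q [/andP[p0 p1] /andP[q0 q1] E1]]].
  by have [] := Br _ (inB _ _ _ _ Kij p01 q01).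
have := @second_difference O f g H x j i s C2f.
case=> [? ? p01 q01|p' [q' [/andP[p'0 p'1] /andP[q'0 q'1] E2]]].
  by have [] := Br _ (inB _ _ _ _ Kji p01 q01).
have [||_ _ Hp] := Br _ (inB _ _ p q Kij _ _); [by rewrite !ltW|by rewrite !ltW|].
have [||_ Hp' _] := Br _ (inB _ _ p' q' Kji _ _); [by rewrite !ltW|by rewrite !ltW|].
have E : H j i (x + (p * s) *: evec R i + (q * s) *: evec R j) =
         H i j (x + (p' * s) *: evec R j + (q' * s) *: evec R i).
  apply: (mulfI (lt0r_neq0 s0)); apply: (mulfI (lt0r_neq0 s0)).
  rewrite -E1 -E2 [x + s *: evec R i + _]addrAC; ring.
move: Hp Hp'; rewrite E; set z := H i j (_ + _) => Hp Hp'.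
have -> : H i j x - H j i x = (H i j x - z) + (z - H j i x) by ring.
rewrite (splitr e) (le_trans (ler_normD _ _))// lerD//.
by rewrite distrC.
Unshelve. all: by end_near. Qed.

End SecondOrder.

(** * Quadratic forms and the Euclidean norm *)

Section QuadraticForms.
Variables (R : realType) (k : nat).
Implicit Types (A : 'I_k -> 'I_k -> R) (u v w h : 'cV[R]_k).

Definition bil_form A u v : R := \sum_(i < k) \sum_(j < k) u i 0 * v j 0 * A i j.

Lemma bil_formDl A u v w (t : R) :
  bil_form A (u + t *: w) v = bil_form A u v + t * bil_form A w v.
Proof.
rewrite /bil_form mulr_sumr -big_split; apply: eq_bigr => i _ /=.
rewrite mulr_sumr -big_split; apply: eq_bigr => j _ /=.
by rewrite !mxE; ring.
Qed.

Lemma bil_formC A u v : (forall i j, A i j = A j i) -> bil_form A u v = bil_form A v u.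
Proof.
move=> As; rewrite /bil_form exchange_big; apply: eq_bigr => i _ /=.
by apply: eq_bigr => j _; rewrite As; ring.
Qed.

Lemma quad_formDZ A h u (t : R) : (forall i j, A i j = A j i) ->
  quad_form A (h + t *: u) = quad_form A h + 2 * t * bil_form A u h + t ^+ 2 * quad_form A u.
Proof.
move=> As; rewrite -[LHS]/(bil_form A _ _) bil_formDl (bil_formC h)// (bil_formC u)//.
by rewrite !bil_formDl (bil_formC h u)// /bil_form /quad_form; ring.
Qed.

Lemma psd_isotropic A h u : (forall i j, A i j = A j i) ->
  (forall v, 0 <= quad_form A v) -> quad_form A h = 0 -> bil_form A u h = 0.
Proof.
move=> As A0 h0; set b := bil_form A u h; set c := quad_form A u.
have c0 : 0 <= c by exact: A0.
(* The step nearly minimises [2 t b + t ^+ 2 * c] in [t]; the denominator [c + 1] avoids division by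
   zero and still gives a negative value unless [b = 0]. *)
have := A0 (h + (- b / (c + 1)) *: u); rewrite quad_formDZ// h0 -/b -/c => H.
have c1 : 0 < c + 1 by rewrite ltr_wpDl.
have E : 0 + 2 * (- b / (c + 1)) * b + (- b / (c + 1)) ^+ 2 * c =
    - (b ^+ 2 * ((c + 2) / (c + 1) ^+ 2)) by field; exact: lt0r_neq0.
move: H; rewrite E oppr_ge0 pmulr_lle0; last first.
  by rewrite divr_gt0 ?exprn_gt0// ltr_wpDl.
by rewrite real_exprn_even_le0 ?num_real// => /eqP.
Qed.

Lemma bil_form_evecl A i h : bil_form A (evec R i) h = \sum_(j < k) A i j * h j 0.
Proof.
rewrite /bil_form (bigD1 i)//= [X in _ + X]big1 ?addr0 => [|a ai].
  by apply: eq_bigr => j _; rewrite !mxE !eqxx mul1r mulrC.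
by apply: big1 => j _; rewrite !mxE (negbTE ai) !mul0r.
Qed.

(** An isotropic vector of a semidefinite form is orthogonal to every basis vector by
    [psd_isotropic], hence lies in the kernel of the matrix, which is trivial here. *)
Lemma pd_of_psd_det A h : (forall i j, A i j = A j i) ->
  (forall v, 0 <= quad_form A v) -> \det (\matrix_(i, j) A i j) != 0 ->
  h != 0 -> 0 < quad_form A h.
Proof.
move=> As A0 dA; rewrite lt0r A0 andbT; apply: contra => /eqP h0.
have Ah : (\matrix_(i, j) A i j) *m h = 0.
  apply/colP => i; rewrite !mxE -[RHS](psd_isotropic (evec R i) As A0 h0).
  by rewrite bil_form_evecl; apply: eq_bigr => j _; rewrite mxE.
by rewrite -(@mulKmx _ _ _ (\matrix_(i, j) A i j) _ h) ?Ah ?mulmx0// unitmxE unitfE.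
Qed.

Lemma isotropic_of_det0 A : \det (\matrix_(i, j) A i j) = 0 ->
  exists2 h, h != 0 & quad_form A h = 0.
Proof.
move=> /eqP/det0P[v v0 vA]; exists v^T.
  by apply: contra v0 => /eqP vT; rewrite -(trmxK v) vT trmx0.
rewrite /quad_form exchange_big; apply: big1 => j _ /=.
transitivity (v 0 j * (v *m \matrix_(i, j) A i j) 0 j).
  rewrite [in RHS]mxE mulr_sumr; apply: eq_bigr => i _; rewrite !mxE; ring.
by rewrite vA mxE mulr0.
Qed.

Lemma quad_formZ A h (t : R) : quad_form A (t *: h) = t ^+ 2 * quad_form A h.
Proof.
rewrite /quad_form mulr_sumr; apply: eq_bigr => i _; rewrite mulr_sumr.
by apply: eq_bigr => j _; rewrite !mxE; ring.
Qed.

End QuadraticForms.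

Section EuclideanSpace.
Variables (R : realType) (k : nat).
Implicit Types (u v w : 'cV[R]_k).

Definition dot u v : R := \sum_(i < k) u i 0 * v i 0.

Lemma dotC u v : dot u v = dot v u.
Proof. by apply: eq_bigr => i _; rewrite mulrC. Qed.

Lemma dotDl u v w : dot (u + v) w = dot u w + dot v w.
Proof. by rewrite -big_split; apply: eq_bigr => i _; rewrite mxE mulrDl. Qed.

Lemma dotZl (a : R) u w : dot (a *: u) w = a * dot u w.
Proof. by rewrite /dot mulr_sumr; apply: eq_bigr => i _; rewrite mxE mulrA. Qed.

Lemma dotNl u w : dot (- u) w = - dot u w.
Proof. by rewrite -scaleN1r dotZl mulN1r. Qed.

Lemma dotBl u v w : dot (u - v) w = dot u w - dot v w.
Proof. by rewrite dotDl dotNl. Qed.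

Lemma dotZr (a : R) u w : dot w (a *: u) = a * dot w u.
Proof. by rewrite !(dotC w) dotZl. Qed.

Lemma dotNr u w : dot w (- u) = - dot w u.
Proof. by rewrite !(dotC w) dotNl. Qed.

Lemma dotBr u v w : dot w (u - v) = dot w u - dot w v.
Proof. by rewrite !(dotC w) dotBl. Qed.

Lemma sqnormE u : sqnorm u = dot u u.
Proof. by []. Qed.

Lemma sqnorm_ge0 u : 0 <= sqnorm u.
Proof. by apply: sumr_ge0 => i _; exact: sqr_ge0. Qed.

Lemma sqnorm_eq0 u : sqnorm u = 0 -> u = 0.
Proof.
move=> /eqP; rewrite psumr_eq0 => [/allP H|i _]; last exact: sqr_ge0.
apply/colP => i; rewrite mxE; apply/eqP; rewrite -sqrf_eq0.
exact: (H i (mem_index_enum i)).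
Qed.

Lemma sqnorm_gt0 u : u != 0 -> 0 < sqnorm u.
Proof. by move=> u0; rewrite lt0r sqnorm_ge0 andbT; apply: contra u0 => /eqP/sqnorm_eq0 ->. Qed.

Lemma sqnorm0 : sqnorm (0 : 'cV[R]_k) = 0.
Proof. by rewrite /sqnorm big1// => i _; rewrite mxE expr0n. Qed.

Lemma enorm_ge0 u : 0 <= enorm u.
Proof. exact: sqrtr_ge0. Qed.

Lemma sqr_enorm u : enorm u ^+ 2 = sqnorm u.
Proof. by rewrite sqr_sqrtr// sqnorm_ge0. Qed.

Lemma enorm_gt0 u : u != 0 -> 0 < enorm u.
Proof. by move=> u0; rewrite sqrtr_gt0 sqnorm_gt0. Qed.

Lemma enorm0 : enorm (0 : 'cV[R]_k) = 0.
Proof. by rewrite /enorm sqnorm0 sqrtr0. Qed.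

Lemma enormZ (a : R) u : enorm (a *: u) = `|a| * enorm u.
Proof.
rewrite /enorm (_ : sqnorm (a *: u) = a ^+ 2 * sqnorm u).
  by rewrite sqrtrM ?sqr_ge0// sqrtr_sqr.
by rewrite !sqnormE dotZl dotZr mulrA -expr2.
Qed.

Lemma enormN u : enorm (- u) = enorm u.
Proof. by rewrite -scaleN1r enormZ normrN1 mul1r. Qed.

Lemma enormB u v : enorm (u - v) = enorm (v - u).
Proof. by rewrite -enormN opprB. Qed.

Lemma cauchy_schwarz u v : `|dot u v| <= enorm u * enorm v.
Proof.
have [->|v0] := eqVneq v 0.
  by rewrite dotC -(scale0r 0) dotZl mul0r normr0 mulr_ge0 ?enorm_ge0.
have nv := sqnorm_gt0 v0.
have H : dot u v ^+ 2 <= sqnorm u * sqnorm v.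
  have := sqnorm_ge0 (u - (dot u v / sqnorm v) *: v).
  have -> : sqnorm (u - (dot u v / sqnorm v) *: v) = sqnorm u - dot u v ^+ 2 / sqnorm v.
    rewrite [LHS]sqnormE !(dotBl, dotBr, dotZl, dotZr) (dotC v u) -!sqnormE.
    by field; exact: lt0r_neq0.
  by rewrite subr_ge0 ler_pdivrMr.
rewrite -(@ler_pXn2r _ 2) ?nnegrE ?mulr_ge0 ?enorm_ge0//.
by rewrite exprMn !sqr_enorm real_normK ?num_real.
Qed.

Lemma dot_le u v : dot u v <= enorm u * enorm v.
Proof. exact: le_trans (ler_norm _) (cauchy_schwarz u v). Qed.

Lemma coord_le_norm u i : `|u i 0| <= `|u|.
Proof.
rewrite [leRHS]/Num.Def.normr /= mx_normrE.
exact: (le_bigmax _ (fun ij : 'I_k * 'I_1 => `|u ij.1 ij.2|) (i, 0)).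
Qed.

(** The topology on column vectors comes from the max norm, whereas distances are Euclidean; this
    bound and [enorm_le_norm] translate between the two. *)
Lemma norm_le_enorm u : `|u| <= enorm u.
Proof.
rewrite [leLHS]/Num.Def.normr /= mx_normrE; apply: bigmax_le => [|[i j] _ /=].
  exact: enorm_ge0.
rewrite (ord1 j) -sqrtr_sqr ler_wsqrtr// /sqnorm (bigD1 i)//= lerDl.
by apply: sumr_ge0 => *; exact: sqr_ge0.
Qed.

Lemma enorm_le_norm u : enorm u <= k%:R * `|u|.
Proof.
rewrite -(@ler_pXn2r _ 2) ?nnegrE ?mulr_ge0 ?enorm_ge0//.
rewrite sqr_enorm (@le_trans _ _ (\sum_(i < k) `|u| ^+ 2))//.
  apply: ler_sum => i _; rewrite -real_normK ?num_real//.
  by rewrite ler_pXn2r ?nnegrE// coord_le_norm.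
rewrite sumr_const card_ord exprMn -[leLHS]mulr_natl ler_wpM2r ?sqr_ge0//.
by rewrite -natrX ler_nat; case: (k) => // n; rewrite leq_pmulr.
Qed.

End EuclideanSpace.

(** * Nearest points and their extension *)

Section Continuity.
Variables (R : realType) (k : nat).

Lemma cvg_sumr (T I : Type) (F : set_system T) {FF : Filter F} (r : seq I)
    (f : I -> T -> R) (l : I -> R) :
  (forall i, f i x @[x --> F] --> l i) ->
  \sum_(i <- r) f i x @[x --> F] --> \sum_(i <- r) l i.
Proof.
move=> fl; apply: cvg_big => [|i _]; [exact: add_continuous|exact: fl].
Qed.

Lemma cvg_coord (T : Type) (F : set_system T) {FF : Filter F} (u : T -> 'cV[R]_k)
    (a : 'cV[R]_k) i : u x @[x --> F] --> a -> u x i 0 @[x --> F] --> a i 0.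
Proof. by move=> ua; apply: (continuous_cvg _ (@coord_continuous R k 1 i 0 a) ua). Qed.

Lemma cvg_dot (T : Type) (F : set_system T) {FF : Filter F} (u v : T -> 'cV[R]_k)
    (a b : 'cV[R]_k) : u x @[x --> F] --> a -> v x @[x --> F] --> b ->
  dot (u x) (v x) @[x --> F] --> dot a b.
Proof. by move=> ua vb; apply: cvg_sumr => i; apply: cvgM; exact: cvg_coord. Qed.

Lemma cvg_Lx (T : Type) (F : set_system T) {FF : Filter F} (u v : T -> 'cV[R]_k)
    (a b : 'cV[R]_k) : u x @[x --> F] --> a -> v x @[x --> F] --> b ->
  Lx (u x) (v x) @[x --> F] --> Lx a b.
Proof.
move=> ua vb; have vu : v x - u x @[x --> F] --> b - a by exact: cvgB.
exact: (cvg_dot vu vu).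
Qed.

Lemma cvg_extend (T : Type) (F : set_system T) {FF : Filter F} (u v : T -> 'cV[R]_k)
    (l : T -> R) (a b : 'cV[R]_k) (r : R) :
  u x @[x --> F] --> a -> v x @[x --> F] --> b -> l x @[x --> F] --> r ->
  v x + (1 + l x) *: (u x - v x) @[x --> F] --> b + (1 + r) *: (a - b).
Proof.
move=> ua vb lr; have uv : u x - v x @[x --> F] --> a - b by exact: cvgB.
have l1 : 1 + l x @[x --> F] --> 1 + r.
  by apply: cvgD lr; exact: cvg_cst.
by apply: cvgD vb _; exact: cvgZ.
Qed.

Lemma sqnorm_continuous : continuous (@sqnorm R k).
Proof. by move=> x; apply: (@cvg_dot _ (nbhs x) _ id id x x). Qed.

Lemma enorm_continuous : continuous (@enorm R k).
Proof.
by move=> x; apply: (continuous_cvg _ (@sqrt_continuous R _) (@sqnorm_continuous x)).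
Qed.

End Continuity.

Section Minimizers.
Variables (R : realType) (s : nat) (M : set 'cV[R]_s).
Implicit Types (x y mu nu : 'cV[R]_s) (l : R).

Definition extend x mu l := mu + (1 + l) *: (x - mu).

Definition extends x mu l := is_minimizer M (extend x mu l) mu.

Lemma extend0 x mu : extend x mu 0 = x.
Proof. by rewrite /extend addr0 scale1r addrC subrK. Qed.

Lemma extendB x mu l : extend x mu l - mu = (1 + l) *: (x - mu).
Proof. by rewrite /extend addrC addKr. Qed.

Lemma LxB x mu nu : Lx x nu - Lx x mu = sqnorm (nu - mu) - 2 * dot (x - mu) (nu - mu).
Proof.
rewrite /Lx !sqnormE !(dotBl, dotBr) (dotC mu nu) (dotC x nu) (dotC x mu); ring.
Qed.

Lemma is_minimizerP x mu : is_minimizer M x mu <->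
  M mu /\ forall nu, M nu -> 2 * dot (x - mu) (nu - mu) <= sqnorm (nu - mu).
Proof.
split=> -[Mmu H]; split=> // nu Mnu; have := H _ Mnu.
  by rewrite -subr_ge0 LxB subr_ge0.
by move=> h; rewrite -subr_ge0 LxB subr_ge0.
Qed.

Lemma extendsP x mu l : extends x mu l <->
  M mu /\ forall nu, M nu -> 2 * (1 + l) * dot (x - mu) (nu - mu) <= sqnorm (nu - mu).
Proof.
by split=> [/is_minimizerP|] H; [|apply/is_minimizerP];
  case: H => Mmu H; split=> // nu /H; rewrite extendB dotZl mulrA.
Qed.

(** In the criterion [extendsP] only those [nu] with positive inner product constrain the ratio, and
    for them the left side increases with it. The ratio -1 corresponds to the point [mu] itself. *)
Lemma extends_le x mu l l' : -1 <= l' -> l' <= l -> extends x mu l -> extends x mu l'.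
Proof.
move=> l'1 l'l /extendsP[Mmu H]; apply/extendsP; split=> // nu Mnu.
have [d0|d0] := leP (dot (x - mu) (nu - mu)) 0.
  rewrite (le_trans _ (sqnorm_ge0 _))// mulr_ge0_le0// mulr_ge0//.
  by rewrite -lerBlDl sub0r.
by rewrite (le_trans _ (H _ Mnu))// ler_pM2r// ler_pM2l// lerD2l.
Qed.

Lemma extends_minimizer x mu l : 0 <= l -> extends x mu l -> is_minimizer M x mu.
Proof.
by move=> l0 /(extends_le _ l0); rewrite /extends extend0; apply; rewrite lerN10.
Qed.

(** Minimality of [nu] gives [sqnorm (nu - mu) <= 2 * dot (x - mu) (nu - mu)], while extendability
    bounds [1 + l] times the right side by the left one; both can hold only if [nu - mu]
    vanishes. *)
Lemma extends_unique x mu nu l : 0 < l -> extends x mu l -> is_minimizer M x nu -> nu = mu.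
Proof.
move=> l0 ext minnu; have [Mnu /(_ mu)] := minnu.
have /extendsP[Mmu /(_ nu Mnu) H] := ext.
move=> /(_ Mmu); rewrite -subr_ge0 -opprB LxB opprB subr_ge0 => H'.
apply/eqP; rewrite -subr_eq0; apply: contraTT H' => nz; rewrite -ltNge.
have n0 := sqnorm_gt0 nz.
have [d0|d0] := leP (dot (x - mu) (nu - mu)) 0.
  by rewrite (le_lt_trans _ n0)// mulr_ge0_le0.
by rewrite (lt_le_trans _ H)// ltr_pM2r// ltr_pMr// ltrDl.
Qed.

(** The extension inequality at [mu] is tested with [mu'], and minimality at [mu'], multiplied by
    [1 + l], with [mu]. Their sum cancels [dot (x - mu) (mu' - mu)] and leaves [l * sqnorm (mu' -
    mu) <= 2 * (1 + l) * dot (x' - x) (mu' - mu)], to which Cauchy-Schwarz applies. *)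
Lemma extends_lipschitz x x' mu mu' l : 0 <= l -> extends x mu l -> is_minimizer M x' mu' ->
  l * enorm (mu' - mu) <= 2 * (1 + l) * enorm (x' - x).
Proof.
move=> l0 /extendsP[Mmu H] /is_minimizerP[Mmu' H'].
have [->|dn] := eqVneq mu' mu.
  by rewrite subrr enorm0 mulr0 !mulr_ge0 ?enorm_ge0// addr_ge0.
have d0 : 0 < enorm (mu' - mu) by rewrite enorm_gt0// subr_eq0.
rewrite -(ler_pM2r d0) -[leLHS]mulrA -[_ * enorm (mu' - mu)]expr2 sqr_enorm -[leRHS]mulrA.
have l1 : 0 < 1 + l by rewrite ltr_wpDr.
apply: (@le_trans _ _ (2 * (1 + l) * dot (x' - x) (mu' - mu))); last first.
  by rewrite ler_pM2l ?mulr_gt0// dot_le.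
have := H _ Mmu'.
have : (1 + l) * (2 * dot (x' - mu') (mu - mu')) <= (1 + l) * sqnorm (mu - mu').
  by rewrite ler_pM2l//; exact: H'.
rewrite -(opprB mu' mu) !sqnormE !(dotNl, dotNr) opprK.
have -> : x' - mu' = (x - mu) + ((x' - x) - (mu' - mu)).
  by apply/colP => i; rewrite !mxE; ring.
rewrite (dotDl (x - mu)) (dotBl (x' - x)).
by set a := dot (x - mu) _; set b := dot (x' - x) _; set c := dot _ _; lra.
Qed.

Hypothesis cM : compact M.

Lemma Lx_continuous x : continuous (Lx x).
Proof. by move=> mu; apply: (cvg_Lx (cvg_cst x) (@cvg_id _ (nbhs mu))). Qed.

Lemma minimizer_exists x : M !=set0 -> exists mu, is_minimizer M x mu.
Proof.
move=> M0; have [|mu Mmu H] := @compact_EVT_min _ R (Lx x) M M0 cM.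
  exact/continuous_subspaceT/Lx_continuous.
by exists mu; split; [exact: set_mem|move=> nu Mnu; apply: H; exact: mem_set].
Qed.

End Minimizers.

(** * Second-order analysis in a chart *)

Section LocalMinima.
Variables (R : realType) (k : nat).
Implicit Types (O : set 'cV[R]_k) (f : 'cV[R]_k -> R) (g : 'I_k -> 'cV[R]_k -> R)
  (H : 'I_k -> 'I_k -> 'cV[R]_k -> R) (x h : 'cV[R]_k).

Lemma is_derive_local_min_ge0 f x h (l : R) : is_derive x h f l ->
  (\forall y \near x, f x <= f y) -> 0 <= l.
Proof.
move=> /is_deriveP fl fx; rewrite leNgt; apply/negP => l0.
have /nbhs_ballP[r /= r0 Br] := fx.
have K0 : 0 < `|h| + 1 by rewrite ltr_wpDl.
have : \forall t \near (0 : R)^', t^-1 *: (f (t *: h + x) - f x) < 0.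
  exact: cvgr_lt fl _ l0.
rewrite near_withinE => /nbhs_ballP[e /= e0 Be].
pose t := Num.min (e / 2) (r / 2 / (`|h| + 1)).
have t0 : 0 < t by rewrite lt_min !divr_gt0.
have : t^-1 *: (f (t *: h + x) - f x) < 0.
  apply: (Be t); last by rewrite /= gt_eqF.
  by rewrite /ball /= sub0r normrN gtr0_norm// gt_min ltr_pdivrMr// ltr_pMr// ltr1n.
rewrite ltNge => /negP; apply; rewrite mulr_ge0 ?invr_ge0 ?(ltW t0)// subr_ge0.
apply: Br; rewrite -ball_normE /= opprD addrCA subrr addr0 normrN normrZ gtr0_norm//.
rewrite (@le_lt_trans _ _ (t * (`|h| + 1)))// ?ler_pM2l// ?lerDl//.
rewrite -ltr_pdivlMr// gt_min; apply/orP; right.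
by rewrite ltr_pM2r ?invr_gt0// ltr_pdivrMr// ltr_pMr// ltr1n.
Qed.

Lemma gradient_local_min O f g H x j : C2_on O f g H -> O x ->
  (\forall y \near x, f x <= f y) -> g j x = 0.
Proof.
move=> [_ df _ _ _] Ox fx; have D := df x j Ox.
apply/eqP; rewrite eq_le (is_derive_local_min_ge0 D fx) andbT -oppr_ge0.
apply: (is_derive_local_min_ge0 _ fx) => //.
by rewrite -mulN1r; exact: is_deriveZ_dir.
Qed.

Lemma cvg_quad_form (T : Type) (F : set_system T) {FF : Filter F}
    (A : 'I_k -> 'I_k -> T -> R) (u : T -> 'cV[R]_k) (A0 : 'I_k -> 'I_k -> R) h :
  (forall i j, A i j t @[t --> F] --> A0 i j) -> u t @[t --> F] --> h ->
  quad_form (fun i j => A i j t) (u t) @[t --> F] --> quad_form A0 h.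
Proof.
move=> AA0 uh; apply: cvg_sumr => i; apply: cvg_sumr => j.
by apply: cvgM; [apply: cvgM; exact: cvg_coord|exact: AA0].
Qed.

Lemma ball_segment x h (r t : R) : 0 <= t <= 1 -> ball x r (x + h) -> ball x r (x + t *: h).
Proof.
move=> /andP[t0 t1]; rewrite -!ball_normE /= !opprD !addrA !subrr !add0r !normrN normrZ.
by apply: le_lt_trans; rewrite ger0_norm// ler_piMl.
Qed.

(** If the form were negative at [h], it would remain so near [x]; Taylor's formula, with vanishing
    first-order term, would then place [f (x + t *: h)] strictly below [f x]. *)
Lemma hessian_local_min O f g H x h : C2_on O f g H -> O x ->
  (\forall y \near x, f x <= f y) -> 0 <= quad_form (fun i j => H i j x) h.
Proof.
move=> C2f Ox fx; have [oO _ _ _ cH] := C2f.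
rewrite leNgt; apply/negP => q0.
have Hq : \forall y \near x, quad_form (fun i j => H i j y) h < 0.
  have Q : quad_form (fun i j => H i j y) h @[y --> x] --> quad_form (fun i j => H i j x) h.
    apply: (@cvg_quad_form _ (nbhs x) _ (fun i j y => H i j y) (fun=> h)).
      by move=> i j; exact: cH.
    exact: (@cvg_cst _ h _ (nbhs x)).
  exact: cvgr_lt Q _ q0.
have /nbhs_ballP[r /= r0 Br] : \forall y \near x,
    [/\ O y, f x <= f y & quad_form (fun i j => H i j y) h < 0].
  by near=> y; split; near: y => //; exact: open_nbhs_nbhs.
have K0 : 0 < `|h| + 1 by rewrite ltr_wpDl.
pose t := r / 2 / (`|h| + 1); have t0 : 0 < t by rewrite !divr_gt0.
have th : ball x r (x + t *: h).
  rewrite -ball_normE /= opprD addrA subrr add0r normrN normrZ gtr0_norm//.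
  rewrite (@le_lt_trans _ _ (t * (`|h| + 1)))// ?ler_pM2l// ?lerDl//.
  by rewrite divfK ?gt_eqF// ltr_pdivrMr// ltr_pMr// ltr1n.
have [|a /andP[a0 a1]] := taylor2 C2f (x := x) (h := t *: h).
  by move=> a a01; have [] := Br _ (ball_segment a01 th).
rewrite big1 => [|j _]; last by rewrite (gradient_local_min _ C2f Ox fx) mulr0.
rewrite add0r quad_formZ => E.
have [_ + _] := Br _ th; rewrite -subr_ge0 E.
apply/negP; rewrite -ltNge pmulr_llt0// pmulr_rlt0 ?exprn_gt0//.
by have [|_ _ ] := Br _ (@ball_segment x (t *: h) r a _ th); rewrite ?(ltW a0) ?(ltW a1).
Unshelve. all: by end_near. Qed.

End LocalMinima.

Section VectorValued.
Variables (R : realType) (V : normedModType R) (s : nat).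
Implicit Types (A B : V -> 'cV[R]_s).

Lemma is_derive_coord A x v (a : 'cV[R]_s) i :
  is_derive x v A a -> is_derive x v (fun w => A w i 0) (a i 0).
Proof.
case=> dA <-; rewrite derive_mx// mxE; apply: derivableP.
by have /derivable_mxP := dA; apply.
Qed.

Lemma is_derive_dot A B x v (a b : 'cV[R]_s) : is_derive x v A a -> is_derive x v B b ->
  is_derive x v (fun w => dot (A w) (B w)) (dot a (B x) + dot (A x) b).
Proof.
move=> dA dB.
have -> : (fun w => dot (A w) (B w)) = \sum_(i < s) ((fun w => A w i 0) * (fun w => B w i 0)).
  by apply/funext => w; rewrite fct_sumE.
apply: is_derive_eq.
  apply: is_derive_sum => i; apply: is_deriveM; exact: is_derive_coord.
rewrite -big_split; apply: eq_bigr => i _ /=; rewrite /GRing.scale /=; ring.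
Qed.

End VectorValued.

Section Charts.
Variables (R : realType) (m s : nat) (O : set 'cV[R]_m) (phi : 'cV[R]_m -> 'cV[R]_s).
Hypotheses (oO : open O) (sphi : smooth_on O phi).
Implicit Types (z y : 'cV[R]_s) (w h : 'cV[R]_m).

Definition chart_gradient z j w : R := 2 * dot (phi w - z) (pd j phi w).

(** Second partials of the squared distance in the chart, by the product rule: the Gram matrix of
    the tangent vectors plus a term linear in [phi w - z]. The explicit form makes joint continuity
    in [z] and [w] visible. *)
Definition chart_hess z i j w : R :=
  2 * (dot (pd i phi w) (pd j phi w) + dot (phi w - z) (pd i (pd j phi) w)).

Lemma smooth_cvg js w : O w -> {for w, continuous (iterpd js phi)}.
Proof.
move=> Ow; have [_] := sphi js; rewrite continuous_open_subspace// => H.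
by apply: H; exact: mem_set.
Qed.

Lemma smooth_is_derive js j w : O w ->
  is_derive w (evec R j) (iterpd js phi) (iterpd (j :: js) phi w).
Proof. by move=> Ow; apply: derivableP; have [H _] := sphi js; exact: H. Qed.

Lemma cvg_chart_hess (T : Type) (F : set_system T) {FF : Filter F} (z : T -> 'cV[R]_s)
    (w : T -> 'cV[R]_m) z0 w0 i j : O w0 ->
  z t @[t --> F] --> z0 -> w t @[t --> F] --> w0 ->
  chart_hess (z t) i j (w t) @[t --> F] --> chart_hess z0 i j w0.
Proof.
move=> Ow0 zz0 ww0.
have C js : iterpd js phi (w t) @[t --> F] --> iterpd js phi w0.
  exact: (continuous_cvg _ (smooth_cvg Ow0) ww0).
apply: cvgM; first exact: cvg_cst.
apply: cvgD; apply: cvg_dot.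
- exact: (C [:: i]).
- exact: (C [:: j]).
- by apply: cvgB => //; exact: (C [::]).
- exact: (C [:: i; j]).
Qed.

Lemma chart_C2 z : C2_on O (fun w => Lx z (phi w)) (chart_gradient z) (chart_hess z).
Proof.
have dB w j : O w -> is_derive w (evec R j) (fun w => phi w - z) (pd j phi w).
  move=> Ow; rewrite -[pd j phi w]subr0.
  have -> : (fun w => phi w - z) = phi - cst z by [].
  by apply: is_deriveB; exact: (smooth_is_derive [::]).
split=> //.
- move=> w j Ow; have D := dB w j Ow.
  by apply: is_derive_eq (is_derive_dot D D) _; rewrite dotC /chart_gradient; ring.
- move=> w i j Ow; have D := dB w i Ow.
  have D2 := smooth_is_derive [:: j] i Ow.
  have -> : chart_gradient z j = 2 \*: (fun w => dot (phi w - z) (pd j phi w)) by [].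
  have D3 : is_derive w (evec R i) (fun w => dot (phi w - z) (pd j phi w)) _ := is_derive_dot D D2.
  exact: (@is_deriveZ _ _ _ _ 2 _ _ _ D3).
- move=> w j Ow.
  have c0 : phi v - z @[v --> w] --> phi w - z.
    have c : phi v @[v --> w] --> phi w := smooth_cvg (js := [::]) Ow.
    exact: (cvgB c (@cvg_cst _ z _ (nbhs w) _)).
  have c1 : pd j phi v @[v --> w] --> pd j phi w := smooth_cvg (js := [:: j]) Ow.
  have c2 : 2 * dot (phi v - z) (pd j phi v) @[v --> w] --> 2 * dot (phi w - z) (pd j phi w).
    exact: (cvgM (@cvg_cst _ (2 : R) _ (nbhs w) _) (cvg_dot c0 c1)).
  exact: c2.
- by move=> w i j Ow; apply: (@cvg_chart_hess _ (nbhs w) _ (fun=> z) id) => //; exact: cvg_cst.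
Qed.

Lemma chart_hessianE z w : O w ->
  chart_hessian z phi w = \matrix_(i, j) chart_hess z i j w.
Proof.
move=> Ow; have [_ df dg _ _] := chart_C2 z.
apply/matrixP => i j; rewrite !mxE /pd.
(* The inner partial derivative equals [chart_gradient] only on [O], which suffices because the
   outer derivative depends on values near [w] alone. *)
rewrite (@near_eq_derive _ _ _ _ (chart_gradient z j)).
  by have [_] := dg w i j Ow.
have := open_nbhs_nbhs (conj oO Ow); apply: filterS => y Oy.
by have [_] := df y j Oy.
Qed.

Lemma jacobian_mulE w h : Defs.jacobian phi w *m h = \sum_(j < m) h j 0 *: pd j phi w.
Proof.
apply/colP => i; rewrite mxE summxE; apply: eq_bigr => j _.
by rewrite !mxE mulrC.
Qed.

Lemma quad_chart_hess z w h : quad_form (fun i j => chart_hess z i j w) h =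
  2 * sqnorm (Defs.jacobian phi w *m h)
  + 2 * \sum_(i < m) \sum_(j < m) h i 0 * h j 0 * dot (phi w - z) (pd i (pd j phi) w).
Proof.
have -> : sqnorm (Defs.jacobian phi w *m h) =
    \sum_(i < m) \sum_(j < m) h i 0 * h j 0 * dot (pd i phi w) (pd j phi w).
  rewrite jacobian_mulE sqnormE.
  have dsl (I : Type) (r : seq I) (u : I -> 'cV[R]_s) v :
      dot (\sum_(i <- r) u i) v = \sum_(i <- r) dot (u i) v.
    elim: r => [|i r IH]; last by rewrite !big_cons dotDl IH.
    by rewrite !big_nil -(scale0r 0) dotZl mul0r.
  rewrite dsl; apply: eq_bigr => i _; rewrite dotC dsl; apply: eq_bigr => j _.
  by rewrite dotZl dotZr (dotC (pd j _ _)) mulrA (mulrC (h j 0)).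
rewrite /quad_form !mulr_sumr -big_split; apply: eq_bigr => i _ /=.
rewrite !mulr_sumr -big_split; apply: eq_bigr => j _ /=.
rewrite /chart_hess; ring.
Qed.

(* Moving [y] along the normal through [phi w] rescales only the second fundamental form. *)
Lemma quad_chart_hess_extend y w h (l : R) :
  quad_form (fun i j => chart_hess (extend y (phi w) l) i j w) h =
  (1 + l) * quad_form (fun i j => chart_hess y i j w) h
  - 2 * l * sqnorm (Defs.jacobian phi w *m h).
Proof.
rewrite !quad_chart_hess.
under eq_bigr => i _ do (under eq_bigr => j _ do
  rewrite -opprB extendB -scalerN opprB dotZl mulrCA).
under eq_bigr do rewrite -mulr_sumr.
by rewrite -mulr_sumr; ring.
Qed.

(** Critical points thus stay critical when the base point moves along the ray from [phi w]. *)
Lemma chart_gradient_extend y w j (l : R) :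
  chart_gradient (extend y (phi w) l) j w = (1 + l) * chart_gradient y j w.
Proof.
by rewrite /chart_gradient -opprB extendB -scalerN opprB dotZl; ring.
Qed.

End Charts.

Lemma cvg_fst_nbhs (T U : topologicalType) (a : T) (b : U) : q.1 @[q --> (a, b)] --> a.
Proof. exact: cvg_fst. Qed.

Lemma cvg_snd_nbhs (T U : topologicalType) (a : T) (b : U) : q.2 @[q --> (a, b)] --> b.
Proof. exact: cvg_snd. Qed.

Lemma cvg_trmx (R : realType) (k : nat) (v : 'rV[R]_k) : u^T @[u --> v] --> v^T.
Proof.
move=> A /nbhs_ballP[e /= e0 eA]; apply/nbhs_ballP; exists e => //= u [_ vu].
by apply: eA; split=> // i j; rewrite !mxE.
Qed.

(** By homogeneity it is enough to test [h] on the unit sphere [S]. Positivity there is an open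
    condition jointly in the vector, the base point and the chart point, and compactness of [S]
    yields one neighbourhood for all vectors. *)
Lemma near_chart_hess_ge0 (R : realType) (m s : nat) (O : set 'cV[R]_m)
    (phi : 'cV[R]_m -> 'cV[R]_s) x w0 : open O -> smooth_on O phi -> O w0 ->
  (forall h, h != 0 -> 0 < quad_form (fun i j => chart_hess phi x i j w0) h) ->
  \forall p \near (x, w0),
    forall h, 0 <= quad_form (fun i j => chart_hess phi p.1 i j p.2) h.
Proof.
move=> oO sphi Ow0 pd0; pose S := [set v : 'rV[R]_m | `|v| = 1].
have cS : compact S.
  apply: bounded_closed_compact.
    by exists 1; split=> // M M1 v /= ->; exact: ltW.
  have -> : S = (fun v : 'rV[R]_m => `|v|) @^-1` [set 1] by [].
  by apply: closed_comp; [move=> v _; exact: norm_continuous|exact: closed_eq].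
have cov : near_covering S by apply/compact_near_coveringP.
have HS : \forall p \near (x, w0), S `<=`
    (fun v => 0 <= quad_form (fun i j => chart_hess phi p.1 i j p.2) v^T).
  apply: (cov _ (nbhs (x, w0)) (fun p v => 0 <= quad_form (fun i j => chart_hess phi p.1 i j p.2) v^T) (nbhs_filter _)) => v /= Sv.
  have vT0 : v^T != 0.
    apply/eqP => /(congr1 trmx); rewrite trmxK trmx0 => v0.
    by move: Sv; rewrite /S /= v0 normr0 => /eqP; rewrite eq_sym oner_eq0.
  have Q : quad_form (fun i j => chart_hess phi q.2.1 i j q.2.2) (q.1)^T @[q --> (v, (x, w0))]
      --> quad_form (fun i j => chart_hess phi x i j w0) v^T.
    apply: (@cvg_quad_form _ _ _ (nbhs (v, (x, w0))) _
      (fun i j q => chart_hess phi q.2.1 i j q.2.2) (fun q => (q.1)^T)).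
      move=> i j; apply: (cvg_chart_hess oO sphi Ow0 (z := fun q => q.2.1)
        (w := fun q => q.2.2)) => //.
        exact: (cvg_comp snd fst (@cvg_snd_nbhs _ _ v (x, w0)) (@cvg_fst_nbhs _ _ x w0)).
      exact: (cvg_comp snd snd (@cvg_snd_nbhs _ _ v (x, w0)) (@cvg_snd_nbhs _ _ x w0)).
    exact: (cvg_comp fst trmx (@cvg_fst_nbhs _ _ v (x, w0)) (@cvg_trmx _ _ v)).
  have : \forall q \near (v, (x, w0)),
      0 < quad_form (fun i j => chart_hess phi q.2.1 i j q.2.2) (q.1)^T.
    exact: cvgr_gt Q _ (pd0 _ vT0).
  by apply: filterS => -[v' p] /= /ltW.
apply: filterS HS => p pS h.
have [->|h0] := eqVneq h 0; first by rewrite -[X in quad_form _ X](scale0r 0) quad_formZ expr0n mul0r.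
have n0 : `|h^T| != 0.
  rewrite normr_eq0; apply: contra h0 => /eqP/(congr1 trmx).
  by rewrite trmxK trmx0 => ->.
have -> : h = `|h^T| *: (`|h^T|^-1 *: h^T)^T.
  by rewrite linearZ /= trmxK scalerA divff// scale1r.
rewrite quad_formZ mulr_ge0 ?sqr_ge0//; apply: pS.
by rewrite /S /= normrZ normfV normr_id mulVf.
Qed.

(** * The cut locus *)

Section Cutlocus.
Variables (R : realType) (m s : nat) (M : set 'cV[R]_s).
Implicit Types (x y z mu nu : 'cV[R]_s).

Lemma ball_convex_segment (k : nat) (w0 w w' : 'cV[R]_k) (r t : R) : 0 <= t <= 1 ->
  ball w0 r w -> ball w0 r w' -> ball w0 r (w + t *: (w' - w)).
Proof.
move=> /andP[t0 t1]; rewrite -!ball_normE /= => wr w'r.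
have -> : w0 - (w + t *: (w' - w)) = (1 - t) *: (w0 - w) + t *: (w0 - w').
  by apply/colP => i; rewrite !mxE; ring.
rewrite (le_lt_trans (ler_normD _ _))// !normrZ (ger0_norm t0) ger0_norm ?subr_ge0//.
have [->|tn0] := eqVneq t 0; first by rewrite subr0 mul1r mul0r addr0.
have -> : r = (1 - t) * r + t * r by ring.
apply: ler_ltD; first by rewrite ler_wpM2l ?subr_ge0// ltW.
by rewrite ltr_pM2l// lt0r tn0.
Qed.

(** The ball is convex, so the Taylor remainder between [w] and [w'] is evaluated inside it, where
    the Hessian form is nonnegative. *)
Lemma convex_critical_min (O : set 'cV[R]_m) phi z w w' w0 (r : R) :
  open O -> smooth_on O phi -> ball w0 r `<=` O ->
  (forall v h, ball w0 r v -> 0 <= quad_form (fun i j => chart_hess phi z i j v) h) ->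
  ball w0 r w -> ball w0 r w' -> (forall j, chart_gradient phi z j w = 0) ->
  Lx z (phi w) <= Lx z (phi w').
Proof.
move=> oO sphi rO Hr rw rw' g0.
have C2z := chart_C2 oO sphi z.
have seg t : 0 <= t <= 1 -> ball w0 r (w + t *: (w' - w)).
  by move=> t01; exact: ball_convex_segment.
have [|t /andP[t0 t1]] := taylor2 C2z (x := w) (h := w' - w).
  by move=> t /seg /rO.
rewrite [w + _]addrC subrK big1 => [|j _]; last by rewrite g0 mulr0.
rewrite add0r => E; rewrite -subr_ge0 E divr_ge0//; apply: Hr; apply: seg.
by rewrite !ltW.
Qed.

Lemma chart_local_min (O : set 'cV[R]_m) U phi y w : local_param M O U phi ->
  O w -> is_minimizer M y (phi w) -> \forall v \near w, Lx y (phi w) <= Lx y (phi v).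
Proof.
move=> [[oO _] _ img _ _] Ow [_ minw].
have := open_nbhs_nbhs (conj oO Ow); apply: filterS => v Ov; apply: minw.
have : (phi @` O) (phi v) by exists v.
by rewrite img => -[].
Qed.

Lemma chart_gradient_min (O : set 'cV[R]_m) U phi y w j : local_param M O U phi ->
  O w -> is_minimizer M y (phi w) -> chart_gradient phi y j w = 0.
Proof.
move=> lp Ow minw; have [[oO _] sphi _ _ _] := lp.
exact: (gradient_local_min j (chart_C2 oO sphi y) Ow (chart_local_min lp Ow minw)).
Qed.

Lemma chart_hess_min (O : set 'cV[R]_m) U phi y w h : local_param M O U phi ->
  O w -> is_minimizer M y (phi w) -> 0 <= quad_form (fun i j => chart_hess phi y i j w) h.
Proof.
move=> lp Ow minw; have [[oO _] sphi _ _ _] := lp.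
exact: (hessian_local_min h (chart_C2 oO sphi y) Ow (chart_local_min lp Ow minw)).
Qed.

(** Continuity of the inverse [psi] on [M] prevents other sheets of [M] from accumulating at
    [phi w0]: nearby points of [M] have parameters near [w0]. *)
Lemma near_chart (O : set 'cV[R]_m) U phi w0 (B : set 'cV[R]_m) : local_param M O U phi ->
  O w0 -> nbhs w0 B ->
  \forall nu \near phi w0, M nu -> exists w, [/\ B w, O w & phi w = nu].
Proof.
move=> [[oO oU] _ img _ [psi [cpsi psiK phiK]]] Ow0 Bw0.
have MUw0 : (M `&` U) (phi w0) by rewrite -img; exists w0.
have cpsi0 : psi @ within (M `&` U) (nbhs (phi w0)) --> psi (phi w0).
  by move/subspace_continuousP : cpsi; exact.
have nB : \forall nu \near phi w0, (M `&` U) nu -> B (psi nu).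
  by apply: (cpsi0 B); rewrite psiK.
have nU := open_nbhs_nbhs (conj oU MUw0.2).
near=> nu => Mnu.
have MUnu : (M `&` U) nu by split=> //; near: nu.
have : (phi @` O) nu by rewrite img.
move=> [w Ow wnu]; exists w; split=> //; rewrite -(psiK w Ow) wnu.
by move: MUnu; near: nu.
Unshelve. all: by end_near. Qed.

(** The tuple [q] packs a competitor, then a base point with its ratio, then a nearest point of that
    base point. The Hessian at [x] is positive definite, so it stays nonnegative for the extended
    base points; the nearest point is still critical for them and therefore beats all competitors in
    the chart ball. *)
Lemma near_extends_local x mu : smooth_submanifold m M ->
  ~ cutlocus m M x -> is_minimizer M x mu ->
  \forall q \near (mu, ((x, 0 : R), mu)), M q.1 ->
    is_minimizer M q.2.1.1 q.2.2 ->
    Lx (extend q.2.1.1 q.2.2 q.2.1.2) q.2.2 <= Lx (extend q.2.1.1 q.2.2 q.2.1.2) q.1.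
Proof.
move=> smooth xC minmu.
have [V [U [phi [Umu lp]]]] := smooth mu minmu.1.
have [[oO oU] sphi img _ _] := lp.
have [w0 Ow0 w0mu] : (phi @` V) mu by rewrite img; split=> //; exact: minmu.1.
subst mu.
have pd0 h : h != 0 -> 0 < quad_form (fun i j => chart_hess phi x i j w0) h.
  apply: pd_of_psd_det.
  - by move=> i j; exact: (hessian_sym i j (chart_C2 oO sphi x) Ow0).
  - by move=> v; exact: (chart_hess_min v lp Ow0 minmu).
  - rewrite -(chart_hessianE oO sphi x Ow0); apply/eqP => det0; apply: xC; right.
    by exists (phi w0); split=> //; exists V, U, phi, w0.
have [[A B] /= [Ax Bw0] AB] := near_chart_hess_ge0 oO sphi Ow0 pd0.
have /nbhs_ballP[r /= r0 rB] : nbhs w0 (B `&` V).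
  by apply: filterI => //; exact: open_nbhs_nbhs.
have nchart := near_chart lp Ow0 (nbhsx_ballx w0 r r0).
have next : \forall p \near ((x, 0 : R), phi w0), A (extend p.1.1 p.2 p.1.2).
  have E : extend p.1.1 p.2 p.1.2 @[p --> ((x, 0 : R), phi w0)] --> extend x (phi w0) 0.
    apply: cvg_extend.
    - exact: (cvg_comp fst fst (@cvg_fst_nbhs _ _ (x, 0 : R) (phi w0)) (@cvg_fst_nbhs _ _ x (0 : R))).
    - exact: cvg_snd_nbhs.
    - exact: (cvg_comp fst snd (@cvg_fst_nbhs _ _ (x, 0 : R) (phi w0)) (@cvg_snd_nbhs _ _ x (0 : R))).
  by move: E; rewrite extend0 => /(_ _ Ax).
pose Q (nu : 'cV[R]_s) := M nu -> exists w, [/\ ball w0 r w, V w & phi w = nu].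
have F1 : \forall q \near (phi w0, ((x, 0 : R), phi w0)), Q q.1.
  exact: (@cvg_fst_nbhs _ _ (phi w0) ((x, 0 : R), phi w0) _ nchart).
have F2 : \forall q \near (phi w0, ((x, 0 : R), phi w0)),
    A (extend q.2.1.1 q.2.2 q.2.1.2).
  exact: (@cvg_snd_nbhs _ _ (phi w0) ((x, 0 : R), phi w0) _ next).
have F3 : \forall q \near (phi w0, ((x, 0 : R), phi w0)), Q q.2.2.
  exact: (@cvg_snd_nbhs _ _ (phi w0) ((x, 0 : R), phi w0) _
    (@cvg_snd_nbhs _ _ (x, 0 : R) (phi w0) _ nchart)).
apply: filterS3 F1 F2 F3 => q Q1 Aq Q3 Mq minq.
have [w' [rw' Ow' <-]] := Q1 Mq.
have [w [rw Ow Ew]] := Q3 minq.1.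
move: Aq minq; rewrite -Ew => Aq minq.
apply: (convex_critical_min oO sphi _ _ rw rw') => [v /rB[]//|v h /rB[Bv _]|j].
  exact: (AB (_, v)).
by rewrite chart_gradient_extend (chart_gradient_min j lp Ow minq) mulr0.
Qed.

(** Around each [nu0] in [M] the comparison holds locally: at [nu0 = mu] by [near_extends_local],
    elsewhere by the strict gap between [Lx x mu] and [Lx x nu0]. Compactness of [M] merges these
    into one neighbourhood. *)
Lemma near_extends x mu : compact M -> smooth_submanifold m M ->
  ~ cutlocus m M x -> is_minimizer M x mu ->
  \forall p \near ((x, 0 : R), mu), is_minimizer M p.1.1 p.2 -> extends M p.1.1 p.2 p.1.2.
Proof.
move=> cM smooth xC minmu.
have umu nu : is_minimizer M x nu -> nu = mu.
  move=> minnu; have [xu|nxu] := pselect (exists! nu, is_minimizer M x nu).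
    by have [a [_ ua]] := xu; rewrite -(ua _ minnu) -(ua _ minmu).
  by case: xC; left.
have cov : near_covering_within M by apply/near_covering_withinP/compact_near_coveringP.
have H : \forall p \near ((x, 0 : R), mu), M `<=` (fun nu => is_minimizer M p.1.1 p.2 ->
    Lx (extend p.1.1 p.2 p.1.2) p.2 <= Lx (extend p.1.1 p.2 p.1.2) nu).
  apply: (cov _ (nbhs ((x, 0 : R), mu)) (fun p nu => is_minimizer M p.1.1 p.2 ->
    Lx (extend p.1.1 p.2 p.1.2) p.2 <= Lx (extend p.1.1 p.2 p.1.2) nu) (nbhs_filter _)).
  move=> nu0 Mnu0.
  have [->|nu0mu] := eqVneq nu0 mu.
    have := near_extends_local smooth xC minmu.
    by apply: filterS => -[nu p].
  have lt0 : Lx x mu < Lx x nu0.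
    rewrite lt_neqAle minmu.2// andbT; apply: contra nu0mu => /eqP E.
    apply/eqP/umu; split=> // nu Mnu; rewrite -E; exact: minmu.2.
  have E : extend q.2.1.1 q.2.2 q.2.1.2 @[q --> (nu0, ((x, 0 : R), mu))] --> extend x mu 0.
    apply: cvg_extend.
    - exact: (cvg_comp snd (fst \o fst) (@cvg_snd_nbhs _ _ nu0 (x, 0 : R, mu))
        (cvg_comp fst fst (@cvg_fst_nbhs _ _ (x, 0 : R) mu) (@cvg_fst_nbhs _ _ x (0 : R)))).
    - exact: (cvg_comp snd snd (@cvg_snd_nbhs _ _ nu0 (x, 0 : R, mu))
        (@cvg_snd_nbhs _ _ (x, 0 : R) mu)).
    - exact: (cvg_comp snd (snd \o fst) (@cvg_snd_nbhs _ _ nu0 (x, 0 : R, mu))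
        (cvg_comp fst snd (@cvg_fst_nbhs _ _ (x, 0 : R) mu) (@cvg_snd_nbhs _ _ x (0 : R)))).
  rewrite extend0 in E.
  have L1 : Lx (extend q.2.1.1 q.2.2 q.2.1.2) q.2.2 @[q --> (nu0, ((x, 0 : R), mu))] --> Lx x mu.
    apply: cvg_Lx => //; exact: (cvg_comp snd snd (@cvg_snd_nbhs _ _ nu0 (x, 0 : R, mu))
        (@cvg_snd_nbhs _ _ (x, 0 : R) mu)).
  have L2 : Lx (extend q.2.1.1 q.2.2 q.2.1.2) q.1 @[q --> (nu0, ((x, 0 : R), mu))] --> Lx x nu0.
    by apply: cvg_Lx => //; exact: cvg_fst_nbhs.
  (* The midpoint separates the two limits, hence also the two functions near the limit point. *)
  pose c := (Lx x mu + Lx x nu0) / 2.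
  have c1 : Lx x mu < c by rewrite /c; lra.
  have c2 : c < Lx x nu0 by rewrite /c; lra.
  have N1 : \forall q \near (nu0, ((x, 0 : R), mu)), Lx (extend q.2.1.1 q.2.2 q.2.1.2) q.2.2 < c.
    exact: cvgr_lt L1 _ c1.
  have N2 : \forall q \near (nu0, ((x, 0 : R), mu)), c < Lx (extend q.2.1.1 q.2.2 q.2.1.2) q.1.
    exact: cvgr_gt L2 _ c2.
  apply: filterS2 N1 N2 => -[nu p] /= h1 h2 _ _; exact/ltW/(lt_trans h1).
apply: filterS H => p Hp minp; split; first exact: minp.1.
by move=> nu Mnu; exact: Hp.
Qed.

(** Along an isotropic [h] the Hessian form of the extended point equals [- 2 * l * sqnorm (J h)],
    with [J] the Jacobian, and is nonnegative by minimality. Hence [J h = 0], contradicting the full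
    rank of the chart. *)
Lemma extends_not_cutlocus x mu (l : R) : 0 < l -> extends M x mu l -> ~ cutlocus m M x.
Proof.
move=> l0 ext.
have minmu := extends_minimizer (ltW l0) ext.
have umu nu : is_minimizer M x nu -> nu = mu by exact: extends_unique l0 ext.
case=> [|[nu [/umu -> [V [U [phi [w0 [lp Ow0 w0mu det0]]]]]]]].
  by apply; exists mu; split=> // nu /umu.
subst mu; have [[oO _] sphi _ rk _] := lp.
rewrite (chart_hessianE oO sphi x Ow0) in det0.
have [h h0 qh] := isotropic_of_det0 det0.
have := chart_hess_min h lp Ow0 ext.
rewrite quad_chart_hess_extend qh mulr0 sub0r oppr_ge0 pmulr_rle0 ?mulr_gt0// => J0.
have {}J0 : Defs.jacobian phi w0 *m h = 0.
  by apply: sqnorm_eq0; apply/eqP; rewrite eq_le J0 sqnorm_ge0.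
have rf : row_free (Defs.jacobian phi w0)^T by rewrite /row_free mxrank_tr rk.
move/negP: h0; apply; apply/eqP; rewrite -(trmxK h).
have /(row_free_inj rf) -> : h^T *m (Defs.jacobian phi w0)^T = 0 *m (Defs.jacobian phi w0)^T.
  by rewrite -trmx_mul J0 trmx0 mul0mx.
by rewrite trmx0.
Qed.

Lemma not_cutlocus_minimizer x : ~ cutlocus m M x -> exists mu, is_minimizer M x mu.
Proof.
move=> xC; apply: contrapT => nex; apply: xC; left => -[mu [minmu _]].
by apply: nex; exists mu.
Qed.

Lemma not_cutlocus_extends x mu : compact M -> smooth_submanifold m M ->
  ~ cutlocus m M x -> is_minimizer M x mu -> exists2 l, 0 < l & extends M x mu l.
Proof.
move=> cM smooth xC minmu.
have [[A B] /= [[[A1 A2] /= [A1x A20] A12] Bmu] AB] := near_extends cM smooth xC minmu.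
have /nbhs_ballP[r /= r0 rA] := A20.
exists (r / 2); first by rewrite divr_gt0.
apply: (AB ((x, r / 2), mu)) => //; split=> /=; last exact: nbhs_singleton.
apply: A12; split=> /=; first exact: nbhs_singleton.
apply: rA; rewrite /ball /= sub0r normrN gtr0_norm ?divr_gt0//.
by rewrite ltr_pdivrMr// ltr_pMr// ltr1n.
Qed.

(** Nearest points of [y] close to [x] are close to [mu] by [extends_lipschitz], so [near_extends]
    makes them extendable by one fixed ratio, and [y] too avoids the cut locus. *)
Lemma cutlocus_closed : compact M -> smooth_submanifold m M -> closed (cutlocus m M).
Proof.
move=> cM smooth; rewrite -[cutlocus m M]setCK; apply: open_closedC.
rewrite openE => x xC; rewrite /interior.
have [mu minmu] := not_cutlocus_minimizer xC.
have [l l0 ext] := not_cutlocus_extends cM smooth xC minmu.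
have [[A B] /= [[[A1 A2] /= [A1x A20] A12] Bmu] AB] := near_extends cM smooth xC minmu.
have /nbhs_ballP[r /= r0 rA] := A20.
have /nbhs_ballP[d /= d0 dB] := Bmu.
(* This is the smallness that turns the Lipschitz bound into [enorm (nu - mu) < d] for a nearest
   point [nu] of [y]. *)
have N : \forall y \near x, 2 * (1 + l) * enorm (y - x) < l * d.
  have c : 2 * (1 + l) * enorm (y - x) @[y --> x] --> 2 * (1 + l) * enorm (x - x).
    have cs : y - x @[y --> x] --> x - x.
      exact: (cvgB (@cvg_id _ (nbhs x)) (@cvg_cst _ x _ (nbhs x) _)).
    have ce : enorm (y - x) @[y --> x] --> enorm (x - x).
      exact: (continuous_cvg _ (@enorm_continuous _ _ _) cs).
    exact: (cvgM (@cvg_cst _ (2 * (1 + l)) _ (nbhs x) _) ce).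
  move: c; rewrite subrr enorm0 mulr0 => c.
  have ld : 0 < l * d by rewrite mulr_gt0.
  exact: cvgr_lt c _ ld.
near=> y.
have [nu minnu] := minimizer_exists cM y (ex_intro _ mu minmu.1).
have Bnu : B nu.
  apply: dB; rewrite -ball_normE /= distrC (le_lt_trans (norm_le_enorm _))//.
  rewrite -(ltr_pM2l l0) (le_lt_trans (extends_lipschitz (ltW l0) ext minnu))//.
  by near: y.
apply: (@extends_not_cutlocus y nu (r / 2)); first by rewrite divr_gt0.
apply: (AB ((y, r / 2), nu)) => //; split=> //=.
apply: A12; split=> /=; first by near: y.
apply: rA; rewrite /ball /= sub0r normrN gtr0_norm ?divr_gt0//.
by rewrite ltr_pdivrMr// ltr_pMr// ltr1n.
Unshelve. all: by end_near. Qed.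

End Cutlocus.

(** * Extension up to the cut locus and the Lipschitz bound for the projection *)

Section Ray.
Variables (R : realType) (m s : nat) (M : set 'cV[R]_s).
Hypotheses (cM : compact M) (smooth : smooth_submanifold m M).
Implicit Types (x t mu nu : 'cV[R]_s) (l : R).

Lemma extend_extend x mu l l' :
  extend (extend x mu l) mu l' = extend x mu (l + l' + l * l').
Proof. by apply/colP => i; rewrite !mxE; ring. Qed.

(* The first point of the ray from [mu] through [t] beyond which [mu] is no longer
   a nearest point lies in the cut locus. *)
Lemma extends_ray t mu l : 0 <= l -> ~ cutlocus m M t -> is_minimizer M t mu ->
  (forall x, cutlocus m M x -> l * enorm (t - mu) < enorm (x - t)) -> extends M t mu l.
Proof.
move=> l0 tC mint far; apply: contrapT => next.
pose S := [set k : R | 0 <= k /\ extends M t mu k].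
have S0 : S 0 by split=> //; rewrite /extends extend0.
have Sl : ubound S l.
  move=> k [k0 extk]; rewrite leNgt; apply/negP => lk; apply: next.
  by apply: (extends_le _ (ltW lk) extk); rewrite (le_trans _ l0)// lerN10.
have hS : has_sup S by split; [exists 0|exists l].
pose a := sup S.
have al : a <= l by apply: ge_sup => //; exists 0.
have a0 : 0 <= a by apply: ub_le_sup => //; exists l.
have exta : extends M t mu a.
  apply/extendsP; split=> [|nu Mnu]; first exact: mint.1.
  have [d0|d0] := leP (dot (t - mu) (nu - mu)) 0.
    by rewrite (le_trans _ (sqnorm_ge0 _))// mulr_ge0_le0// mulr_ge0// addr_ge0.
  (* Solved for the ratio, the inequality for a fixed [nu] becomes an upper bound on [S], so it
     passes to the supremum [a]. *)
  rewrite mulrAC -ler_pdivlMl ?mulr_gt0// -lerBrDl; apply: ge_sup; first by exists 0.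
  move=> k [_ /extendsP[_ /(_ nu Mnu)]].
  by rewrite mulrAC -ler_pdivlMl ?mulr_gt0// -lerBrDl.
have xC : ~ cutlocus m M (extend t mu a).
  move=> /far; apply/negP; rewrite -leNgt.
  have -> : extend t mu a - t = a *: (t - mu) by apply/colP => i; rewrite !mxE; ring.
  by rewrite enormZ ger0_norm// ler_wpM2r// enorm_ge0.
(* Extending further by [k] from the point at ratio [a] reaches the ratio [a + k + a * k], which
   exceeds the supremum. *)
have [k k0] := not_cutlocus_extends cM smooth xC exta.
rewrite /extends extend_extend => extk.
have : a + k + a * k <= a.
  apply: ub_le_sup; first by exists l.
  by split=> //; rewrite !addr_ge0 ?mulr_ge0// ltW.
have : 0 <= a * k by rewrite mulr_ge0// ltW.
lra.
Qed.

Lemma nearest_minimizer x : ~ cutlocus m M x -> is_minimizer M x (nearest M x).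
Proof. by move=> /not_cutlocus_minimizer[mu minmu]; apply: (xgetPex 0); exists mu. Qed.

Lemma le_enorm_sqnorm x t : (enorm x <= enorm t) = (sqnorm x <= sqnorm t).
Proof. by rewrite ler_sqrt// sqnorm_ge0. Qed.

Lemma dist_minimizer x mu : is_minimizer M x mu -> enorm (x - mu) <= dist x M.
Proof.
move=> [Mmu minmu]; apply: lb_le_inf; first by exists (enorm (x - mu)), mu.
move=> _ [nu Mnu <-]; rewrite enormB (enormB x) le_enorm_sqnorm; exact: minmu.
Qed.

Lemma dist_le (A : set 'cV[R]_s) x a : A a -> dist x A <= enorm (x - a).
Proof.
move=> Aa; apply: ge_inf; last by exists a.
by exists 0 => _ [b _ <-]; exact: enorm_ge0.
Qed.

Lemma dist_closed_gt0 (A : set 'cV[R]_s) x : closed A -> A !=set0 -> ~ A x -> 0 < dist x A.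
Proof.
move=> cA [a Aa] nAx.
have : nbhs x (~` A) by apply: open_nbhs_nbhs; split=> //; exact: closed_openC.
move=> /nbhs_ballP[e /= e0 eA]; apply: (lt_le_trans e0).
apply: lb_le_inf; first by exists (enorm (x - a)), a.
move=> _ [b Ab <-]; rewrite leNgt; apply/negP => be; apply: (eA b) => //.
by rewrite -ball_normE /= (le_lt_trans (norm_le_enorm _)).
Qed.

Lemma nearest_lipschitz t t' (D d : R) : 0 < D -> 0 < d -> ~ cutlocus m M t ->
  dist t M <= D -> (forall x, cutlocus m M x -> d <= enorm (x - t)) -> ~ cutlocus m M t' ->
  d * enorm (nearest M t' - nearest M t) <= 2 * (2 * D + d) * enorm (t' - t).
Proof.
move=> D0 d0 tC tD far t'C.
have mint := nearest_minimizer tC.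
(* With this ratio the extension beyond [t] has length at most [d / 2], because [t] lies within [D]
   of its nearest point; it therefore stays strictly within the clearance [d]. *)
have l0 : 0 < d / (2 * D) by rewrite divr_gt0// mulr_gt0.
have ext : extends M t (nearest M t) (d / (2 * D)).
  apply: (extends_ray (ltW l0) tC mint) => x /far; apply: lt_le_trans.
  rewrite (@le_lt_trans _ _ (d / (2 * D) * D))//.
    by rewrite ler_pM2l// (le_trans (dist_minimizer mint)).
  have -> : d / (2 * D) * D = d / 2 by field; exact: lt0r_neq0.
  by rewrite ltr_pdivrMr// ltr_pMr// ltr1n.
have := extends_lipschitz (ltW l0) ext (nearest_minimizer t'C).
have D2 : 0 < 2 * D by rewrite mulr_gt0.
rewrite -(ler_pM2l D2).
set u := enorm (_ - nearest M t); set v := enorm _.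
have -> : 2 * D * (d / (2 * D) * u) = d * u by field; exact: lt0r_neq0.
have -> : 2 * D * (2 * (1 + d / (2 * D)) * v) = 2 * (2 * D + d) * v.
  by field; exact: lt0r_neq0.
by [].
Qed.

End Ray.

(** * Tightness *)

Section OperatorNorm.
Variables (R : realType) (s : nat).
Implicit Types (A : 'M[R]_s) (v : 'cV[R]_s).

(** A crude constant is enough: it makes the supremum defining [opnorm] finite and forces [opnorm]
    to 0 along with the entries. *)
Lemma enorm_mulmx_le A v : enorm (A *m v) <= (s * s)%:R * `|A| * enorm v.
Proof.
have Av : `|A *m v| <= s%:R * `|A| * enorm v.
  rewrite [leLHS]/Num.Def.normr /= mx_normrE; apply: bigmax_le => [|[i j] _ /=].
    by rewrite !mulr_ge0// enorm_ge0.
  rewrite (ord1 j) mxE (le_trans (ler_norm_sum _ _ _))//.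
  rewrite (@le_trans _ _ (\sum_(k < s) `|A| * enorm v))//.
    apply: ler_sum => k _; rewrite normrM ler_pM//.
      rewrite [leRHS]/Num.Def.normr /= mx_normrE.
      exact: (le_bigmax _ (fun ij : 'I_s * 'I_s => `|A ij.1 ij.2|) (i, k)).
    exact: le_trans (coord_le_norm _ _) (norm_le_enorm _).
  by rewrite sumr_const card_ord -[leLHS]mulr_natl mulrA.
rewrite (le_trans (enorm_le_norm _))// natrM -!mulrA ler_wpM2l// mulrA.
exact: Av.
Qed.

Let opset A := [set enorm (A *m v) | v in [set v : 'cV[R]_s | enorm v <= 1]].

Let opset0 A : opset A 0.
Proof. by exists 0; rewrite /= ?mulmx0 enorm0. Qed.

Let opset_ub A : ubound (opset A) ((s * s)%:R * `|A|).
Proof.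
move=> _ [v /= v1 <-]; rewrite (le_trans (enorm_mulmx_le _ _))//.
by rewrite ler_piMr// mulr_ge0.
Qed.

Lemma opnorm_ge0 A : 0 <= opnorm A.
Proof. by apply: ub_le_sup; [exists ((s * s)%:R * `|A|); exact: opset_ub|exact: opset0]. Qed.

Lemma opnorm_le A : opnorm A <= (s * s)%:R * `|A|.
Proof. by apply: ge_sup; [exists 0; exact: opset0|exact: opset_ub]. Qed.

Lemma opnorm_mulmx A v : enorm (A *m v) <= opnorm A * enorm v.
Proof.
have [->|v0] := eqVneq v 0; first by rewrite mulmx0 enorm0 mulr0.
have n0 := enorm_gt0 v0.
rewrite -ler_pdivrMr//; apply: ub_le_sup.
  by exists ((s * s)%:R * `|A|); exact: opset_ub.
exists ((enorm v)^-1 *: v); rewrite /= ?enormZ ?gtr0_norm ?invr_gt0 ?mulVf ?gt_eqF//.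
by rewrite -scalemxAr enormZ gtr0_norm ?invr_gt0// mulrC.
Qed.

Lemma opnorm_cvg0 (A : nat -> 'M[R]_s) : A @ \oo --> (0 : 'M[R]_s) ->
  opnorm (A n) @[n --> \oo] --> 0.
Proof.
move=> A0; apply: (@squeeze_cvgr _ _ _ _ (fun=> 0) (fun n => (s * s)%:R * `|A n|)).
- by apply: nearW => n; rewrite opnorm_ge0 opnorm_le.
- exact: (@cvg_cst _ (0 : R) _ (nbhs \oo) _).
- have n0 : `|A n| @[n --> \oo] --> `|0 : 'M[R]_s| by exact: cvg_norm.
  rewrite -(mulr0 (s * s)%:R) -(normr0 'M[R]_s).
  exact: (cvgM (@cvg_cst _ ((s * s)%:R : R) _ (nbhs \oo) _) n0).
Qed.

End OperatorNorm.

Section Tightness.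
Variables (R : realType) (s : nat).

Lemma random_vector_sqnorm d (T : measurableType d) (X : T -> 'cV[R]_s) :
  random_vector X -> measurable_fun setT (fun w => sqnorm (X w)).
Proof.
by move=> mX; apply: measurable_sum => i; exact: measurable_funX (mX i).
Qed.

Lemma random_vector_enorm d (T : measurableType d) (X : T -> 'cV[R]_s) :
  random_vector X -> measurable_fun setT (fun w => enorm (X w)).
Proof.
move=> mX; have ms : measurable_fun setT (@Num.sqrt R).
  by apply: continuous_measurable_fun; exact: sqrt_continuous.
exact: (measurableT_comp ms (random_vector_sqnorm mX)).
Qed.

Lemma measurable_superlevel d (T : measurableType d) (r : R) (f : T -> R) :
  measurable_fun setT f -> measurable [set w | r <= f w].
Proof.
by move=> mf; rewrite -[X in measurable X]setTI; exact: measurable_fun_le.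
Qed.

Lemma random_vector_affine d (T : measurableType d) (X : T -> 'cV[R]_s) (A : 'M[R]_s) a :
  random_vector X -> random_vector (fun w => A *m (X w - a)).
Proof.
move=> mX i.
rewrite (_ : (fun w => _) = (fun w => \sum_(j < s) A i j * (X w j 0 - a j 0))); last first.
  by apply/funext => w; rewrite mxE; apply: eq_bigr => j _; rewrite !mxE.
apply: measurable_sum => j; apply: measurable_funM; first exact: measurable_cst.
by apply: measurable_funB; [exact: mX|exact: measurable_cst].
Qed.

(** A continuous bounded substitute for the indicator of large vectors: at least 1/2 once [sqnorm y]
    reaches [k.+1], and tending to 0 in [k] for fixed [y]. *)
Definition tail_weight (k : nat) (y : 'cV[R]_s) : R := sqnorm y / (k.+1%:R + sqnorm y).

Let den_gt0 k (y : 'cV[R]_s) : 0 < k.+1%:R + sqnorm y.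
Proof. by rewrite ltr_pwDl// sqnorm_ge0. Qed.

Lemma tail_weight_ge0 k y : 0 <= tail_weight k y.
Proof. by rewrite divr_ge0 ?sqnorm_ge0// ltW. Qed.

Lemma tail_weight_le1 k y : tail_weight k y <= 1.
Proof. by rewrite ler_pdivrMr// mul1r lerDr. Qed.

Lemma tail_weight_continuous k : continuous (tail_weight k).
Proof.
move=> y; have sy : sqnorm z @[z --> y] --> sqnorm y by exact: sqnorm_continuous.
have dy : k.+1%:R + sqnorm z @[z --> y] --> k.+1%:R + sqnorm y.
  exact: (cvgD (@cvg_cst _ (k.+1%:R : R) _ (nbhs y) _) sy).
exact: (cvgM sy (cvgV (lt0r_neq0 (den_gt0 k y)) dy)).
Qed.

Lemma tail_weight_measurable d (T : measurableType d) (X : T -> 'cV[R]_s) k :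
  random_vector X -> measurable_fun setT (fun w => tail_weight k (X w)).
Proof.
move=> mX; have mq := random_vector_sqnorm mX.
(* The absolute value makes [g] continuous on the whole line and changes nothing at [sqnorm (X w)],
   which is nonnegative. *)
pose g (r : R) := (k.+1%:R + `|r|)^-1.
have cg : continuous g.
  move=> r; have n : k.+1%:R + `|q| @[q --> r] --> k.+1%:R + `|r|.
    exact: (cvgD (@cvg_cst _ (k.+1%:R : R) _ (nbhs r) _) (@norm_continuous _ _ r)).
  by apply: (cvgV _ n); rewrite lt0r_neq0// ltr_pwDl.
rewrite (_ : (fun w => _) = (fun w => sqnorm (X w)) \* (g \o (fun w => sqnorm (X w)))).
  apply: measurable_funM => //; apply: measurableT_comp => //.
  exact: continuous_measurable_fun.
by apply/funext => w; rewrite /g /= ger0_norm// sqnorm_ge0.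
Qed.

Lemma tail_weight_cvg0 (y : 'cV[R]_s) : tail_weight k y @[k --> \oo] --> 0.
Proof.
have h : (k.+1%:R : R)^-1 @[k --> \oo] --> 0 by exact: cvg_harmonic.
apply: (@squeeze_cvgr _ _ _ _ (fun=> 0) (fun k => sqnorm y * k.+1%:R^-1)).
- apply: nearW => k; rewrite tail_weight_ge0 ler_wpM2l ?sqnorm_ge0//.
  by rewrite lef_pV2 ?posrE// lerDl sqnorm_ge0.
- exact: (@cvg_cst _ (0 : R) _ (nbhs \oo) _).
- rewrite -(mulr0 (sqnorm y)).
  exact: (cvgM (@cvg_cst _ (sqnorm y) _ (nbhs \oo) _) h).
Qed.

Lemma tail_weight_integral_cvg0 d (T : measurableType d) (P : probability T R)
  (X : T -> 'cV[R]_s) : random_vector X ->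
  (\int[P]_w (tail_weight k (X w))%:E @[k --> \oo] --> 0)%E.
Proof.
move=> mX.
have := @dominated_cvg _ T R P setT measurableT (fun k w => (tail_weight k (X w))%:E)
  (fun=> 0%E) (fun=> 1%E).
rewrite integral0; apply.
- by move=> k; apply/measurable_EFinP; exact: tail_weight_measurable.
- by move=> w _; apply: cvg_EFin; [exact: nearW|exact: tail_weight_cvg0].
- by [].
- exact: finite_measure_integrable_cst.
- by move=> k w _; rewrite /= lee_fin ger0_norm ?tail_weight_ge0 ?tail_weight_le1.
Qed.

(** Some [tail_weight k] has expectation below [e / 2] under the limit law; convergence in
    distribution carries this to large [n], and Markov's inequality at level 1/2 bounds the tail by
    [e]. *)
Lemma cvg_dist_tight d d' (T : measurableType d) (T' : measurableType d')
    (P : probability T R) (P' : probability T' R)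
    (X : nat -> T -> 'cV[R]_s) (Z : T' -> 'cV[R]_s) :
  (forall n, random_vector (X n)) -> random_vector Z -> cvg_dist P X P' Z ->
  forall e : R, 0 < e -> exists2 K : R, 0 < K &
    \forall n \near \oo, (P [set w | (K <= enorm (X n w))%R] < e%:E)%E.
Proof.
move=> mX mZ XZ e e0.
have e20 : ((0 : R)%:E < (e / 2)%:E)%E by rewrite lte_fin divr_gt0.
have [k kZ] : exists k, (\int[P']_w (tail_weight k (Z w))%:E < (e / 2)%:E)%E.
  have N : \forall k \near \oo, (\int[P']_w (tail_weight k (Z w))%:E < (e / 2)%:E)%E.
    exact: (tail_weight_integral_cvg0 P' mZ (open_ereal_lt' e20)).
  by have [k] := filter_ex N; exists k.
exists (Num.sqrt k.+1%:R); first by rewrite sqrtr_gt0.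
have bnd : exists K : R, forall y, `|tail_weight k y| <= K.
  by exists 1 => y; rewrite ger0_norm ?tail_weight_ge0 ?tail_weight_le1.
have N : \forall n \near \oo, (\int[P]_w (tail_weight k (X n w))%:E < (e / 2)%:E)%E.
  exact: (XZ (tail_weight k) (@tail_weight_continuous k) bnd _ (open_ereal_lt' kZ)).
apply: filterS N => n Xn.
have mt := tail_weight_measurable k (mX n).
have mark : ((2^-1)%:E * P [set w | (2^-1 <= tail_weight k (X n w))%R] < (e / 2)%:E)%E.
  apply: le_lt_trans Xn.
  have := @le_integral_abse _ T R P setT measurableT (fun w => (tail_weight k (X n w))%:E) 2^-1.
  rewrite setTI invr_gt0 ltr0n => /(_ _ isT).
  under eq_integral do rewrite /= ger0_norm ?tail_weight_ge0//.
  under eq_set do rewrite /= ger0_norm ?tail_weight_ge0// lee_fin.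
  by apply; exact/measurable_EFinP.
have sub : [set w | Num.sqrt k.+1%:R <= enorm (X n w)] `<=`
    [set w | 2^-1 <= tail_weight k (X n w)].
  move=> w /=; rewrite ler_sqrt ?sqnorm_ge0// => kq.
  by rewrite ler_pdivlMr// ler_pdivrMl//; lra.
have mK (r : R) (f : T -> R) : measurable_fun setT f -> measurable [set w | r <= f w].
  exact: measurable_superlevel.
apply: (@le_lt_trans _ _ (P [set w | (2^-1 <= tail_weight k (X n w))%R])).
  apply: le_measure => //; rewrite inE; last exact: mK.
  by apply: mK; exact: random_vector_enorm.
by move: mark; rewrite [X in (_ < X)%E](_ : _ = (2^-1)%:E * e%:E)%E ?lte_pmul2l//;
  rewrite -EFinM mulrC.
Qed.

End Tightness.

(** Convergence in probability is expressed by measurable sets [E n] covering the bad event, so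
    measurability of the projection need not be addressed. The bad event includes hitting the cut
    locus, where [nearest] is not the intended projection. *)
Theorem theorem2p1 (R : realType) (m s : nat) (M : set 'cV[R]_s)
  (d : measure_display) (T : measurableType d) (P : probability T R)
  (d' : measure_display) (T' : measurableType d') (P' : probability T' R)
  (t : nat -> 'cV[R]_s) (tt : nat -> T -> 'cV[R]_s)
  (B : nat -> 'M[R]_s) (Z : T' -> 'cV[R]_s) (D : R) :
  compact M -> smooth_submanifold m M ->
  (forall n, random_vector (tt n)) -> random_vector Z ->
  (forall n, B n \in unitmx) -> B @ \oo --> (0 : 'M[R]_s) ->
  cvg_dist P (fun n w => invmx (B n) *m (tt n w - t n)) P' Z ->
  (forall n, ~ cutlocus m M (t n)) ->
  0 < D -> (forall n, dist (t n) M <= D) ->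
  (fun n => opnorm (B n) / dist (t n) (cutlocus m M)) @ \oo --> 0 ->
  forall eps : R, 0 < eps ->
    exists E : nat -> set T,
      [/\ forall n, measurable (E n),
          forall n, [set w | cutlocus m M (tt n w) \/
                       eps < enorm (nearest M (tt n w) - nearest M (t n))]
                    `<=` E n &
          (fun n => P (E n)) @ \oo --> 0%E].
Proof.
move=> cM smooth mtt mZ Bu B0 XZ tC D0 tD BC eps eps0.
have b0 := opnorm_cvg0 B0.
(* If the cut locus is empty, its distance has the junk value [0]; any positive
   constant then serves as clearance. *)
have [delta [delta0 far bdelta]] : exists delta : nat -> R, [/\ forall n, 0 < delta n,
    forall n x, cutlocus m M x -> delta n <= enorm (x - t n) &
    opnorm (B n) / delta n @[n --> \oo] --> 0].
  have [C0|noC] := pselect (cutlocus m M !=set0).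
    exists (fun n => dist (t n) (cutlocus m M)); split=> // n.
      exact: dist_closed_gt0 (cutlocus_closed cM smooth) C0 (tC n).
    by move=> x Cx; rewrite enormB; exact: dist_le.
  exists (fun=> 1); split=> // [n x Cx|]; first by case: noC; exists x.
  by under eq_fun do rewrite divr1.
(* Within the first radius [tt n w] avoids the cut locus; within the second the bound of
   [nearest_lipschitz] falls below [eps]. *)
pose r n := Num.min (delta n) (eps * delta n / (2 * (2 * D + delta n))).
have c0 n : 0 < 2 * (2 * D + delta n) by rewrite mulr_gt0// addr_gt0// mulr_gt0.
pose E n := [set w | r n <= enorm (tt n w - t n)].
have mE n : measurable (E n).
  apply/measurable_superlevel/random_vector_enorm.
  have := random_vector_affine 1%:M (t n) (mtt n).
  by under eq_fun do rewrite mul1mx.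
exists E; split => // [n w|].
- rewrite /E /= => bad; rewrite leNgt; apply/negP; rewrite lt_min => /andP[close1 close2].
  have ttC : ~ cutlocus m M (tt n w) by move=> /(far n); rewrite leNgt close1.
  case: bad => // /ltW; rewrite -(ler_pM2l (delta0 n)) => bad.
  have := nearest_lipschitz cM smooth D0 (delta0 n) (tC n) (tD n) (far n) ttC.
  move=> /(le_trans bad); apply/negP; rewrite -ltNge.
  by rewrite mulrC (mulrC (delta n)) -ltr_pdivlMr.
apply/fine_cvgP; split; first by apply: nearW => n; exact: fin_num_measure.
apply/cvgrPdist_lt => e e0.
have mX n : random_vector (fun w => invmx (B n) *m (tt n w - t n)).
  exact: random_vector_affine.
have [K K0 HK] := cvg_dist_tight mX mZ XZ e0.
have N1 : \forall n \near \oo, opnorm (B n) / delta n < K^-1.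
  by apply: (cvgr_lt _ bdelta); rewrite invr_gt0.
(* This is [K * opnorm (B n) * (2 * (2 * D + delta n)) < eps * delta n] divided by [K * delta n];
   the term without [delta n] is controlled by [B0]. *)
have N2 : \forall n \near \oo, 4 * D * (opnorm (B n) / delta n) + 2 * opnorm (B n) < eps / K.
  have L : 4 * D * (opnorm (B n) / delta n) + 2 * opnorm (B n) @[n --> \oo]
      --> 4 * D * 0 + 2 * 0.
    exact: (cvgD (cvgM (@cvg_cst _ (4 * D) _ (nbhs \oo) _) bdelta)
      (cvgM (@cvg_cst _ (2 : R) _ (nbhs \oo) _) b0)).
  by apply: (cvgr_lt _ L); rewrite !mulr0 addr0 divr_gt0.
apply: filterS3 HK N1 N2 => n Pn n1 n2.
have br : K * opnorm (B n) < r n.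
  rewrite lt_min; apply/andP; split.
    by move: n1; rewrite ltr_pdivrMr// ltr_pdivlMl.
  rewrite ltr_pdivlMr//.
  move: n2; rewrite ltr_pdivlMr// -(ltr_pM2r (delta0 n)); apply: le_lt_trans.
  rewrite le_eqVlt; apply/orP; left; apply/eqP; field; exact: lt0r_neq0.
rewrite sub0r normrN ger0_norm ?fine_ge0//.
rewrite -lte_fin fineK ?fin_num_measure//; apply: le_lt_trans Pn.
apply: le_measure; rewrite ?inE//.
  exact/measurable_superlevel/random_vector_enorm.
(* Contrapositive: if the normalised vector has norm below [K], then applying [B n] to it gives a
   displacement of norm at most [K * opnorm (B n)], which is less than [r n]. *)
move=> w; rewrite /E /= leNgt => far_w; rewrite leNgt; apply: contra far_w => Xw.
apply: le_lt_trans br.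
rewrite -[X in enorm X](mulKVmx (Bu n)) (le_trans (opnorm_mulmx _ _))// mulrC.
by rewrite ler_wpM2r ?opnorm_ge0// ltW.
Qed.
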